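(* Let $k$ be a field of characteristic $2$, let $q\ge2$ be a power of $2$, and let $N$ be a finite-dimensional $kD_{4q}$-module. 1. If $w\in\mathcal{W}$ is a word with directed components $w_i$, $i\in\{1,\dots,m\}$, and $M=M(w)$ is a $kD_{4q}$-module, then $$\ell(M\otimes N)=\max\{\ell(M(w_i)\otimes N)\mid i\in\{1,\dots,m\}\}.$$ 2. Let $m$ and $n$ be positive integers, $w\in\mathcal{W}'$ a word with directed components $w_i$, $i\in\{1,\dots,2m\}$, $\varphi$ an indecomposable linear automorphism of $k^n$, and suppose $M=M(w,\varphi)$ is a $kD_{4q}$-module. If $m$ and $n$ are not both equal to $1$, then $$\ell(M(w,\varphi)\otimes N)=\max\{\ell(M(w_i)\otimes N)\mid i\in\{1,\dots,2m\}\}.$$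
   Context: $D_{4q}=\langle g,h\mid g^2=h^2=(gh)^{2q}=1\rangle$ is the dihedral group of order $4q$. With $X=1+g$, $Y=1+h$ one has $kD_{4q}\cong k\langle X,Y\rangle/(X^2,Y^2,(XY)^q+(YX)^q)$. Modules are finite dimensional. Tensor products are over $k$ with diagonal group action, that is, $Z(m\otimes n)=Zm\otimes n+m\otimes Zn+Zm\otimes Zn$ for $Z\in\{X,Y\}$. $\ell(M)=\min\{n\in\mathbb{N}\mid\mathrm{rad}^n(kD_{4q})M=0\}$ is the Loewy length. Words. $\mathcal{W}$ is the set of words $a_1\cdots a_r$ ($r\ge 0$) in the letters $X,X^{-1},Y,Y^{-1}$ in which letters from $\{X,X^{-1}\}$ and $\{Y,Y^{-1}\}$ alternate; $1$ is the empty word. $\mathcal{W}'\subset\mathcal{W}$ is the set of words of even positive length that are not powers of a shorter word and contain letters from both $\{X,Y\}$ and $\{X^{-1},Y^{-1}\}$. A directed subword of $w$ is a word $w'$ all of whose letters lie in $\{X,Y\}$, or all of whose letters lie in $\{X^{-1},Y^{-1}\}$, such that $w=w_1w'w_2$ for some $w_1,w_2\in\mathcal{W}$. A directed component of $w$ is a maximal directed subword; every word is uniquely the product of its directed components (the empty word has itself as its only directed component). String modules. For $w=a_1\cdots a_r\in\mathcal{W}$, $M(w)$ has basis $e_0,\dots,e_r$, and $Z\in\{X,Y\}$ acts by $Ze_i=e_{i-1}$ if $i>0$ and $a_i=Z$; $Ze_i=e_{i+1}$ if $i<r$ and $a_{i+1}=Z^{-1}$; $Ze_i=0$ otherwise.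 Band modules. A linear automorphism $\varphi$ of $k^n$ is indecomposable if $k^n$ is not the direct sum of two non-zero $\varphi$-invariant subspaces. For $w=a_1\cdots a_r\in\mathcal{W}'$ and such $\varphi$, $M(w,\varphi)=\bigoplus_{i=0}^{r-1}V_i$ where each $V_i$ is a copy of $k^n$ with basis $e^{(i)}_0,\dots,e^{(i)}_{n-1}$. Let $T$ be the linear automorphism with $T(e_j^{(i)})=e_j^{(i-1)}$ for $i\ge2$, $T(e_j^{(1)})=\varphi(e_j^{(0)})$ (with $\varphi$ viewed as a map $V_0\to V_0$), $T(e_j^{(0)})=e_j^{(r-1)}$, and let $a_0:=a_r$. Then $Z\in\{X,Y\}$ acts by $Ze_j^{(i)}=T(e_j^{(i)})$ if $a_i=Z$; $Ze_j^{(i)}=T^{-1}(e_j^{(i)})$ if $a_{i+1}=Z^{-1}$; $Ze_j^{(i)}=0$ otherwise. *)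

(* Defs.v *)
(* boolp is used only for the classical minimum in loewy_length. *)
From mathcomp Require Import all_boot all_order all_algebra all_fingroup.
From mathcomp Require Import all_solvable all_field all_character.
From mathcomp Require Import boolp.

Set Implicit Arguments.
Unset Strict Implicit.
Unset Printing Implicit Defensive.

Import GRing.Theory.
Local Open Scope ring_scope.

(* The group presented by < g, h | g^2, h^2, (gh)^2q > has order 4q, so these
   conditions determine (G, g, h) up to isomorphism.                          *)
Definition dihedral_gens (gT : finGroupType) (G : {group gT}) (q : nat)
    (g h : gT) : Prop :=
  [/\ <<[set g; h]>>%g = G, #|G| = (4 * q)%N
    & [/\ (g ^+ 2 = 1)%g, (h ^+ 2 = 1)%g & ((g * h) ^+ (2 * q) = 1)%g]].

Section Words.

(* The letter (z, s) is Z if s = false and Z^-1 if s = true, where Z is X if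
   z = false and Y if z = true.                                               *)
Definition letter : Type := (bool * bool)%type.

Implicit Types w u : seq letter.

Definition is_word w : bool := sorted (fun a b : letter => a.1 != b.1) w.

Definition is_band_word w : Prop :=
  [/\ is_word w, (0 < size w)%N /\ ~~ odd (size w),
      forall u t, (size u < size w)%N -> w <> flatten (nseq t u)
    & has (fun a : letter => ~~ a.2) w /\ has (fun a : letter => a.2) w].

Definition directed w : bool :=
  all (fun a : letter => ~~ a.2) w || all (fun a : letter => a.2) w.

(* Occurrences of subwords of w are encoded by their pairs of end points: the
   occurrence (i, j) is a_(i+1) ... a_j. Maximality of directed subwords refers
   to occurrences, and distinct occurrences count as distinct components.     *)
Definition occurrence w : finType := ('I_(size w).+1 * 'I_(size w).+1)%type.

Definition subword w (p : occurrence w) : seq letter := drop p.1 (take p.2 w).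

Definition directed_occurrence w (p : occurrence w) : bool :=
  (p.1 <= p.2)%N && directed (subword p).

Definition directed_components w : {set occurrence w} :=
  [set p | directed_occurrence p &
     [forall p' : occurrence w,
        [&& directed_occurrence p', (p'.1 <= p.1)%N & (p.2 <= p'.2)%N]
          ==> (p' == p)]].

(* a_i, for 1 <= i <= r. *)
Definition letter_at w (i : nat) : letter := nth (false, false) w i.-1.

End Words.

(* A left kG-module with a basis of d elements is a representation rM of degree
   d, with rM x acting on COLUMN vectors of coordinates: column i of a matrix
   holds the coordinates of the image of the i-th basis vector.               *)
Section Modules.

Variable k : fieldType.

Definition string_mx (w : seq letter) (z : bool) : 'M[k]_((size w).+1) :=
  \matrix_(j, i)
    if (0 < i)%N && (letter_at w i == (z, false)) then (j == i.-1 :> nat)%:R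
    else if (i < size w)%N && (letter_at w i.+1 == (z, true))
         then (j == i.+1 :> nat)%:R
    else 0.

Definition indecomposable_automorphism n (phi : 'End('cV[k]_n)) : Prop :=
  lker phi = 0%VS /\
  ~ exists U V : {vspace 'cV[k]_n},
      [/\ U != 0%VS /\ V != 0%VS, (phi @: U <= U)%VS, (phi @: V <= V)%VS,
          (U + V)%VS = fullv & (U :&: V)%VS = 0%VS].

(* The basis vector e_j^(i) has index p with enum_val p = (i, j). *)
Definition band_index r n : finType := ('I_r * 'I_n)%type.

(* ord_pred is the cyclic predecessor on 'I_r. *)
Definition band_shift r n (phi : 'End('cV[k]_n)) : 'M[k]_#|band_index r n| :=
  \matrix_(p, p')
    let: (i, j) := (enum_val p : band_index r n) in
    let: (i', j') := (enum_val p' : band_index r n) in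
    if i == ord_pred i' then
      if i' == 1%N :> nat then phi (delta_mx j' 0) j 0 else (j == j')%:R
    else 0.

Definition band_mx (w : seq letter) n (phi : 'End('cV[k]_n)) (z : bool) :
    'M[k]_#|band_index (size w) n| :=
  \matrix_(p, p')
    let i' := (enum_val p' : band_index (size w) n).1 in
    let a := letter_at w (if i' == 0%N :> nat then size w else i') in
    if a == (z, false) then band_shift (size w) phi p p'
    else if letter_at w i'.+1 == (z, true)
         then invmx (band_shift (size w) phi) p p'
    else 0.

(* The representation rM has X = 1 + g and Y = 1 + h acting by the matrices
   A false and A true; it is determined on G by g and h.                      *)
Definition XY_action (gT : finGroupType) (G : {group gT}) (g h : gT) d
    (rM : mx_representation k G d) (A : bool -> 'M[k]_d) : Prop :=
  1%:M + rM g = A false /\ 1%:M + rM h = A true.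

Definition maximal_left_ideal m n (R : 'A[k]_(m, n)) (L : 'A[k]_n) : Prop :=
  [/\ (L <= R)%MS, left_mx_ideal R L, ~~ (R <= L)%MS
    & forall L' : 'A[k]_n, (L' <= R)%MS -> left_mx_ideal R L' ->
        (L <= L')%MS -> (L' <= L)%MS \/ (R <= L')%MS].

(* Jacobson radical. *)
Definition in_rad m n (R : 'A[k]_(m, n)) (A : 'M[k]_n) : Prop :=
  (A \in R)%MS /\
  forall L : 'A[k]_n, maximal_left_ideal R L -> (A \in L)%MS.

Fixpoint in_rad_pow m n (R : 'A[k]_(m, n)) (t : nat) (A : 'M[k]_n) : Prop :=
  if t is t'.+1 then
    exists s : seq ('M[k]_n * 'M[k]_n),
      (forall B, B \in s -> in_rad R B.1 /\ in_rad_pow R t' B.2) /\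
      A = \sum_(B <- s) B.1 *m B.2
  else (A \in R)%MS.

(* rad^t(kG)M = 0; gring_op rM is the action of kG, extended linearly from G. *)
Definition rad_pow_kills (gT : finGroupType) (G : {group gT}) d
    (rM : mx_representation k G d) (t : nat) : Prop :=
  forall A : 'M[k]_#|G|,
    in_rad_pow (group_ring k G) t A -> gring_op rM A = 0.

(* The radical of kG is nilpotent, so the default value 0 is never used. *)
Definition loewy_length (gT : finGroupType) (G : {group gT}) d
    (rM : mx_representation k G d) : nat :=
  if pselect (exists t, `[< rad_pow_kills rM t >]) is left ex
  then ex_minn ex else 0.

End Modules.

(* Main.v *)
(* The Loewy length of M (x) N only depends on which elements of kG annihilate
   it; the radical is nilpotent because it lies in the augmentation ideal and G
   is a 2-group. If the direction of w = u v changes between u and v, then either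
   M(u) and M(v) are submodules of M(w) whose sum is M(w), or they are quotients
   of M(w) and M(w) embeds into their direct sum. In both cases M(w) (x) N is
   annihilated by the elements that annihilate M(u) (x) N and M(v) (x) N, which
   settles strings by induction. In a band module, a vector of k^n and a pair of
   consecutive components u (positive) and v (negative) define a homomorphism
   from M(u v), and the images span the module. It is injective unless u v runs
   around the whole band and the vector is an eigenvector of phi. If u v does run
   around the whole band, then m = 1, so that n > 1 and phi is not scalar, and its
   non-eigenvectors span k^n. *)
From HB Require Import structures.
Require Import Defs.
From mathcomp Require Import all_boot all_order all_algebra all_fingroup.
From mathcomp Require Import all_solvable all_field all_character.
From mathcomp Require Import boolp zify ring.

Set Implicit Arguments.
Unset Strict Implicit.
Unset Printing Implicit Defensive.

Import GRing.Theory.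
Local Open Scope ring_scope.

(** * Tensor products and intertwiners *)

(** That the string module of a component carries an action of kG is not assumed but produced: it
    arises as a subquotient of M. Since X and Y determine the action, any two choices are
    annihilated by the same elements. For bands the obstacle is that the two end vectors of M(u v)
    fall into the same copy of k^n when u v goes once around. Up to an automorphism they are then y
    and the preimage of y under phi, which are dependent exactly when y is an eigenvector; for m = n
    = 1 this cannot be avoided. An even number of components means that the first and the last
    letter of w have opposite directions. Hence no run of equally directed letters passes from the
    end of w to its beginning, and the components of w are the runs of the cyclic word. *)

Section TensorLinearity.

Variable F : fieldType.

Lemma tprodDl m1 n1 m2 n2 (A A' : 'M[F]_(m1, n1)) (B : 'M[F]_(m2, n2)) :
  tprod (A + A') B = tprod A B + tprod A' B.
Proof.
elim: m1 A A' => [|m1 IH] A A' /=; first by rewrite addr0.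
by rewrite !linearD /= IH -!trowbE linearD /= add_col_mx.
Qed.

Lemma tprodZl m1 n1 m2 n2 c (A : 'M[F]_(m1, n1)) (B : 'M[F]_(m2, n2)) :
  tprod (c *: A) B = c *: tprod A B.
Proof.
elim: m1 A => [|m1 IH] A /=; first by rewrite scaler0.
by rewrite !linearZ /= IH -!trowbE linearZ /= scale_col_mx.
Qed.

End TensorLinearity.

Section Intertwiners.

Variables (k : fieldType) (gT : finGroupType) (G : {group gT}).

Lemma gring_op_sum n (rG : mx_representation k G n) (A : 'M[k]_#|G|) :
  gring_op rG A = \sum_i gring_row A 0 i *: rG (enum_val i).
Proof.
rewrite gring_opE /gring_mx /= mulmx_sum_row linear_sum /=.
by apply: eq_bigr => i _; rewrite linearZ /= rowK mxvecK.
Qed.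

Lemma gring_op_intertwine n1 n2 (r1 : mx_representation k G n1)
    (r2 : mx_representation k G n2) (f : 'M_(n2, n1)) A :
  (forall x, x \in G -> f *m r1 x = r2 x *m f) ->
  f *m gring_op r1 A = gring_op r2 A *m f.
Proof.
move=> fJ; rewrite !gring_op_sum mulmx_sumr mulmx_suml.
by apply: eq_bigr => i _; rewrite -scalemxAr -scalemxAl fJ ?enum_valP.
Qed.

Lemma prod_repr_intertwine n1 n2 d (r1 : mx_representation k G n1)
    (r2 : mx_representation k G n2) (N : mx_representation k G d)
    (f : 'M_(n2, n1)) A :
  (forall x, x \in G -> f *m r1 x = r2 x *m f) ->
  tprod f 1%:M *m gring_op (prod_repr r1 N) A
    = gring_op (prod_repr r2 N) A *m tprod f 1%:M.
Proof.
move=> fJ; apply: gring_op_intertwine => x Gx /=.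
by rewrite -!tprodE fJ // mul1mx mulmx1.
Qed.

Variables g h : gT.
Hypothesis genG : <<[set g; h]>>%g = G.

Lemma generators_in : (g \in G) * (h \in G).
Proof. by rewrite -genG !mem_gen ?inE ?eqxx ?orbT. Qed.

(** There is no case for inverses: in a finite group, a subset that contains 1 and is closed under
    products is a subgroup. *)
Lemma generators_ind (P : gT -> Prop) :
  P 1%g -> (forall x y, x \in G -> y \in G -> P x -> P y -> P (x * y)%g) ->
  P g -> P h -> forall x, x \in G -> P x.
Proof.
move=> P1 PM Pg Ph x Gx.
suff: x \in [set x in G | `[< P x >]] by rewrite inE => /andP[_ /asboolP].
have gS : group_set [set x in G | `[< P x >]].
  apply/group_setP; split; first by rewrite inE group1; apply/asboolP.
  move=> y z; rewrite !inE => /andP[Gy /asboolP Py] /andP[Gz /asboolP Pz].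
  by rewrite groupM //=; apply/asboolP/PM.
move: x Gx; apply/subsetP; rewrite -{1}genG (gen_subG _ (Group gS)).
by apply/subsetP=> y /set2P[] ->; rewrite inE generators_in; apply/asboolP.
Qed.

Lemma XY_intertwine n1 n2 (r1 : mx_representation k G n1)
    (r2 : mx_representation k G n2) A1 A2 (f : 'M_(n2, n1)) :
  XY_action g h r1 A1 -> XY_action g h r2 A2 ->
  (forall z, f *m A1 z = A2 z *m f) ->
  forall x, x \in G -> f *m r1 x = r2 x *m f.
Proof.
move=> [g1 h1] [g2 h2] fA; apply: generators_ind.
- by rewrite !repr_mx1 mulmx1 mul1mx.
- move=> x y Gx Gy fx fy; rewrite !repr_mxM //.
  by rewrite mulmxA fx -(mulmxA (r2 x) f) fy mulmxA.
- have := fA false; rewrite -g1 -g2 mulmxDr mulmxDl mulmx1 mul1mx.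
  exact: addrI.
- have := fA true; rewrite -h1 -h2 mulmxDr mulmxDl mulmx1 mul1mx.
  exact: addrI.
Qed.

(** This is how a string module acquires its kG-structure: the column space of [J] is stable under X
    and Y, hence under G, and [B] is the restricted action. That [B] satisfies the relations of G is
    a consequence. *)
Lemma subrepr n l (r : mx_representation k G n) A (J : 'M_(n, l)) J' B :
  XY_action g h r A -> J' *m J = 1%:M ->
  (forall z, A z *m J = J *m B z) ->
  exists s : mx_representation k G l,
    XY_action g h s B /\ forall x, x \in G -> J *m s x = r x *m J.
Proof.
move=> [gA hA] J'J AJ; pose s x := J' *m r x *m J.
have genJ x C : 1%:M + r x = C -> forall D, C *m J = J *m D ->
    r x *m J = J *m (D - 1%:M).
  move=> <- D CJ; rewrite mulmxBr -CJ mulmxDl mul1mx mulmx1.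
  by rewrite addrAC subrr add0r.
have sJ : forall x, x \in G -> r x *m J = J *m s x.
  (* A matrix [D] of the restricted action is unique, since [J] has a left inverse; so only
     stability remains to be checked. *)
  have redJ x D : r x *m J = J *m D -> r x *m J = J *m s x.
    by move=> rJ; rewrite /s -mulmxA rJ (mulmxA J') J'J mul1mx.
  apply: generators_ind.
  - by apply: (redJ _ 1%:M); rewrite repr_mx1 mul1mx mulmx1.
  - move=> x y Gx Gy xJ yJ; apply: (redJ _ (s x *m s y)).
    by rewrite repr_mxM // -mulmxA yJ (mulmxA (r x)) xJ -!mulmxA.
  - exact/redJ/(genJ _ _ gA)/AJ.
  - exact/redJ/(genJ _ _ hA)/AJ.
have reprs : mx_repr G s.
  split=> [|x y Gx Gy]; first by rewrite /s repr_mx1 mulmx1.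
  have -> : s (x * y)%g = J' *m (r x *m (r y *m J)).
    by rewrite /s repr_mxM // !mulmxA.
  by rewrite sJ // (mulmxA (r x)) sJ // -(mulmxA J) (mulmxA J') J'J mul1mx.
exists (MxRepresentation reprs); split; last by move=> x /sJ.
have genS x C : x \in G -> 1%:M + r x = C -> forall D, C *m J = J *m D ->
    1%:M + s x = D.
  move=> Gx rC D CJ; rewrite /s -mulmxA (genJ _ _ rC _ CJ) mulmxA J'J mul1mx.
  by rewrite addrC subrK.
have [Gg Gh] := generators_in.
by split; [apply: (genS _ _ Gg gA) | apply: (genS _ _ Gh hA)].
Qed.

(** Dual of [subrepr]: the kernel of the surjection [P] is a submodule. *)
Lemma quorepr n l (r : mx_representation k G n) A (P : 'M_(l, n)) P' B :
  XY_action g h r A -> P *m P' = 1%:M ->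
  (forall z, P *m A z = B z *m P) ->
  exists s : mx_representation k G l,
    XY_action g h s B /\ forall x, x \in G -> P *m r x = s x *m P.
Proof.
move=> [gA hA] PP' PA; pose s x := P *m r x *m P'.
have genP x C : 1%:M + r x = C -> forall D, P *m C = D *m P ->
    P *m r x = (D - 1%:M) *m P.
  move=> <- D PC; rewrite mulmxBl -PC mulmxDr mul1mx mulmx1.
  by rewrite addrAC subrr add0r.
have sP : forall x, x \in G -> P *m r x = s x *m P.
  have redP x D : P *m r x = D *m P -> P *m r x = s x *m P.
    by move=> rP; rewrite /s rP -(mulmxA D) PP' mulmx1.
  apply: generators_ind.
  - by apply: (redP _ 1%:M); rewrite repr_mx1 mul1mx mulmx1.
  - move=> x y Gx Gy xP yP; apply: (redP _ (s x *m s y)).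
    by rewrite repr_mxM // mulmxA xP -(mulmxA (s x)) yP !mulmxA.
  - exact/redP/(genP _ _ gA)/PA.
  - exact/redP/(genP _ _ hA)/PA.
have reprs : mx_repr G s.
  split=> [|x y Gx Gy]; first by rewrite /s repr_mx1 mulmx1.
  have -> : s (x * y)%g = P *m r x *m r y *m P'.
    by rewrite /s repr_mxM // !mulmxA.
  by rewrite sP // -(mulmxA (s x)) sP // -(mulmxA (s x)) -(mulmxA (s y)) PP' mulmx1.
exists (MxRepresentation reprs); split; last by move=> x /sP.
have genS x C : x \in G -> 1%:M + r x = C -> forall D, P *m C = D *m P ->
    1%:M + s x = D.
  move=> Gx rC D PC; rewrite /s (genP _ _ rC _ PC) -mulmxA PP' mulmx1.
  by rewrite addrC subrK.
have [Gg Gh] := generators_in.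
by split; [apply: (genS _ _ Gg gA) | apply: (genS _ _ Gh hA)].
Qed.

End Intertwiners.

(** * Annihilators of tensor products with N *)

Section Killing.

Variables (k : fieldType) (gT : finGroupType) (G : {group gT}).
Variables (d : nat) (N : mx_representation k G d).

Definition kills n (r : mx_representation k G n) (A : 'M[k]_#|G|) : Prop :=
  gring_op (prod_repr r N) A = 0.

(** The columns of [tprod x 1%:M] span the column space of [x] tensored with N; [A] is required to
    annihilate this subspace. *)
Definition killed n (r : mx_representation k G n) A m (x : 'M[k]_(n, m)) : Prop :=
  gring_op (prod_repr r N) A *m tprod x 1%:M = 0.

Section Fixed.

Variables (n : nat) (r : mx_representation k G n) (A : 'M[k]_#|G|).

Lemma killedD m (x y : 'M_(n, m)) :
  killed r A x -> killed r A y -> killed r A (x + y).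
Proof. by rewrite /killed tprodDl mulmxDr => -> ->; rewrite addr0. Qed.

Lemma killedZ m c (x : 'M_(n, m)) : killed r A x -> killed r A (c *: x).
Proof. by rewrite /killed tprodZl -scalemxAr => ->; rewrite scaler0. Qed.

Lemma killedM m l (x : 'M_(n, m)) (y : 'M_(m, l)) :
  killed r A x -> killed r A (x *m y).
Proof.
rewrite /killed => kx.
by rewrite -[1%:M](mulmx1 1%:M) tprodE mulmxA kx mul0mx.
Qed.

Lemma killed1 : killed r A 1%:M -> kills r A.
Proof. by rewrite /killed tprod1 mulmx1. Qed.

Lemma killed0 m : killed r A (0 : 'M_(n, m)).
Proof. by rewrite -(scale0r 0) /killed tprodZl scale0r mulmx0. Qed.

Lemma killed_sum (I : Type) (s : seq I) (P : pred I) m (F : I -> 'M_(n, m)) :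
  (forall i, P i -> killed r A (F i)) -> killed r A (\sum_(i <- s | P i) F i).
Proof. by move=> kF; elim/big_ind: _ => //; [apply: killed0 | apply: killedD]. Qed.

Lemma killed_cols :
  (forall i, killed r A (delta_mx i 0 : 'cV_n)) -> kills r A.
Proof.
move=> kd; apply: killed1.
have -> : 1%:M = \sum_i (delta_mx i (0 : 'I_1) *m delta_mx 0 i) :> 'M[k]_n.
  by rewrite mx1_sum_delta; apply: eq_bigr => i _; rewrite mul_delta_mx.
by apply: killed_sum => i _; apply/killedM/kd.
Qed.

End Fixed.

Section Morphism.

Variables (n1 n2 : nat) (r1 : mx_representation k G n1).
Variables (r2 : mx_representation k G n2) (f : 'M[k]_(n2, n1)).
Hypothesis fJ : forall x, x \in G -> f *m r1 x = r2 x *m f.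
Variable A : 'M[k]_#|G|.

Lemma kills_killed_image : kills r1 A -> killed r2 A f.
Proof. by rewrite /killed -(prod_repr_intertwine _ _ fJ) => ->; rewrite mulmx0. Qed.

Lemma kills_quo f' : f *m f' = 1%:M -> kills r1 A -> kills r2 A.
Proof. by move=> ff' /kills_killed_image/(killedM f'); rewrite ff' => /killed1. Qed.

Lemma kills_tprod_mul :
  kills r2 A -> tprod f 1%:M *m gring_op (prod_repr r1 N) A = 0.
Proof. by rewrite (prod_repr_intertwine _ _ fJ) => ->; rewrite mul0mx. Qed.

Lemma kills_sub f' : f' *m f = 1%:M -> kills r2 A -> kills r1 A.
Proof.
move=> f'f /kills_tprod_mul f0.
rewrite /kills -[LHS]mul1mx -tprod1 -f'f -[1%:M](mulmx1 1%:M) tprodE.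
by rewrite -mulmxA f0 mulmx0.
Qed.

End Morphism.

(** [f1'] and [f2'] form a linear left inverse of the map from M to the direct sum of the two
    modules, so M embeds into that sum. They need not commute with G. *)
Lemma kills_joint_sub n n1 n2 (r : mx_representation k G n)
    (r1 : mx_representation k G n1) (r2 : mx_representation k G n2)
    (f1 : 'M_(n1, n)) (f2 : 'M_(n2, n)) f1' f2' A :
  (forall x, x \in G -> f1 *m r x = r1 x *m f1) ->
  (forall x, x \in G -> f2 *m r x = r2 x *m f2) ->
  f1' *m f1 + f2' *m f2 = 1%:M -> kills r1 A -> kills r2 A -> kills r A.
Proof.
move=> fJ1 fJ2 ff /(kills_tprod_mul fJ1) k1 /(kills_tprod_mul fJ2) k2.
rewrite /kills -[LHS]mul1mx -tprod1 -ff tprodDl mulmxDl.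
by rewrite -[1%:M](mulmx1 1%:M) !tprodE -!mulmxA k1 k2 !mulmx0 addr0.
Qed.

(** Here [f1'] and [f2'] form a right inverse: the two images together span M. *)
Lemma kills_joint_quo n n1 n2 (r : mx_representation k G n)
    (r1 : mx_representation k G n1) (r2 : mx_representation k G n2)
    (f1 : 'M_(n, n1)) (f2 : 'M_(n, n2)) f1' f2' A :
  (forall x, x \in G -> f1 *m r1 x = r x *m f1) ->
  (forall x, x \in G -> f2 *m r2 x = r x *m f2) ->
  f1 *m f1' + f2 *m f2' = 1%:M -> kills r1 A -> kills r2 A -> kills r A.
Proof.
move=> fJ1 fJ2 ff /(kills_killed_image fJ1) k1 /(kills_killed_image fJ2) k2.
by apply: killed1; rewrite -ff; apply: killedD; apply: killedM.
Qed.

Lemma kills_XY n g h A (r1 r2 : mx_representation k G n) C :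
  <<[set g; h]>>%g = G -> XY_action g h r1 C -> XY_action g h r2 C ->
  kills r1 A -> kills r2 A.
Proof.
move=> genG rC1 rC2; apply: (@kills_quo _ _ r1 r2 1%:M _ _ 1%:M); last exact: mulmx1.
by apply: (XY_intertwine genG rC1 rC2) => z; rewrite mulmx1 mul1mx.
Qed.

End Killing.

(** * String modules *)

Section StringModules.

Variable k : fieldType.

Local Notation letter0 := (false, false).

(* For s = false, whether Z maps e_j to e_i in M(w); s = true transposes. *)
Definition string_arrow (s : bool) (w : seq letter) (z : bool) (i j : nat) :=
  (j == i.+1) && (nth letter0 w i == (z, s))
  || (i == j.+1) && (nth letter0 w j == (z, ~~ s)).

(** [string_mx] takes the first case that applies, whereas [string_arrow] is a disjunction. They
    agree because neighbouring letters of a word have different underlying generators, so that a_i =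
    Z and a_(i+1) = Z^-1 exclude each other. *)
Lemma string_mxE w z i j : is_word w ->
  string_mx k w z i j = (string_arrow false w z i j)%:R.
Proof.
move=> ww; rewrite mxE /string_arrow /letter_at.
have alt t : (t.+1 < size w)%N -> (nth letter0 w t).1 != (nth letter0 w t.+1).1.
  exact: (sortedP letter0 ww).
case: j => -[|j] ltj /=.
  have [w0|w_gt0] := posnP (size w).
    have := ltn_ord i; case: (@eqP _ (i : nat) 1%N) => /= [->|_ _].
      by rewrite w0.
    by rewrite ?andbF ?orbF; case: i.
  by case: (_ == (z, true)); case: (i == _ :> nat).
rewrite eqSS; have [/eqP wj|nwj] /= := boolP (nth letter0 w j == (z, false)).
  case: (eqVneq (i : nat) j.+2) => [ij|_] /=; last first.
    rewrite eq_sym orbF; case: (eqVneq (i : nat) j) => [->|] //.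
    by rewrite wj eqxx.
  have lt_j : (j.+1 < size w)%N by have := ltn_ord i; rewrite ij.
  have -> : (i == j :> nat) = false by rewrite ij; lia.
  have -> : (j == i) = false by rewrite ij; lia.
  case: (@eqP _ (nth letter0 w j.+1) (z, true)) => //= wj'; have := alt _ lt_j.
  by rewrite wj wj' eqxx.
have -> /= : (j == i) && (nth letter0 w i == (z, false)) = false.
  by case: (@eqP _ j (i : nat)) nwj => //= -> /negPf.
have [ltj'|] := ltnP; first by case: (i == _ :> nat); case: (_ == (z, true)).
by move=> lejw; case: (@eqP _ (i : nat) j.+2) => //= ij; have := ltn_ord i; lia.
Qed.

(** Inclusion of the span of e_o, ..., e_(o+l); its transpose is the coordinate projection. *)
Definition shift_mx n l o : 'M[k]_(n.+1, l.+1) :=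
  \matrix_(i, j) (i == (j + o)%N :> nat)%:R.

Lemma mul_shift_mx n l o p (B : 'M_(l.+1, p)) (i : 'I_n.+1) j :
  (shift_mx n l o *m B) i j
    = if (o <= i <= l + o)%N then B (inord (i - o)) j else 0.
Proof.
rewrite mxE; case: ifP => [/andP[oi il]|out].
  have lt_io : (i - o < l.+1)%N by lia.
  rewrite (bigD1 (inord (i - o))) //= mxE inordK // subnK // eqxx mul1r.
  rewrite big1 ?addr0 // => t; rewrite mxE -val_eqE /= inordK // => nt.
  by case: eqP => [it|]; [move: nt; rewrite it addnK eqxx | rewrite mul0r].
rewrite big1 // => t _; rewrite mxE; case: eqP => [it|]; last by rewrite mul0r.
by have := ltn_ord t; move: out; rewrite it; lia.
Qed.

Lemma mulmx_shift n l o p (A : 'M_(p, n.+1)) i (j : 'I_l.+1) : (l + o <= n)%N ->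
  (A *m shift_mx n l o) i j = A i (inord (j + o)).
Proof.
move=> le_lo; have lt_jo : (j + o < n.+1)%N by have := ltn_ord j; lia.
rewrite mxE (bigD1 (inord (j + o))) //= mxE inordK // eqxx mulr1.
rewrite big1 ?addr0 // => t; rewrite mxE -val_eqE /= inordK // => /negPf->.
exact: mulr0.
Qed.

Lemma shift_mx_trK n l o : (l + o <= n)%N ->
  (shift_mx n l o)^T *m shift_mx n l o = 1%:M.
Proof.
move=> le_lo; apply/matrixP=> i j; rewrite mulmx_shift // !mxE.
have lt_jo : (j + o < n.+1)%N by have := ltn_ord j; lia.
by rewrite inordK // eqn_add2r eq_sym.
Qed.

Definition subword_at (x w : seq letter) o :=
  (size x + o <= size w)%N /\
  forall t, (t < size x)%N -> nth letter0 w (t + o) = nth letter0 x t.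

(** For s = false, the letters next to the subword make every arrow across its ends point into it,
    so arrows that start inside stay inside. For s = true all arrows are reversed, and the same
    argument serves quotients. *)
Lemma string_arrow_subword s x w o z i j : subword_at x w o ->
  ((0 < o)%N -> (nth letter0 w o.-1).2 != s) ->
  ((size x + o < size w)%N -> (nth letter0 w (size x + o)).2 == s) ->
  (i <= size w)%N -> (j <= size x)%N ->
  string_arrow s w z i (j + o)
    = (o <= i <= size x + o)%N && string_arrow s x z (i - o) j.
Proof.
move=> [le_xw wx] lw rw iw jx; rewrite /string_arrow.
have [lt_io|le_oi] /= := ltnP i o.
  have -> : (i == (j + o).+1) = false by lia.
  apply/negbTE/negP; rewrite orbF => /andP[/eqP ji /eqP wi].
  have io : i = o.-1 by lia.
  by have := lw (leq_ltn_trans (leq0n i) lt_io); rewrite -io wi eqxx.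
have [le_ix|lt_xi] /= := leqP i (size x + o).
  have [i' def_i] : exists i', i = (i' + o)%N by exists (i - o)%N; rewrite subnK.
  have le_i'x : (i' <= size x)%N by lia.
  rewrite def_i addnK -!addSn !eqn_add2r.
  by congr (_ || _); case: (@eqP nat _ _) => //= ij; rewrite wx //; lia.
have -> : (j + o == i.+1)%N = false by lia.
apply/negbTE/negP => /= /andP[/eqP ij /eqP wj]; have jxE : j = size x by lia.
by have := rw ltac:(lia); rewrite -jxE wj; case: (s).
Qed.

Lemma string_subword_sub x w o z : is_word w -> is_word x -> subword_at x w o ->
  ((0 < o)%N -> (nth letter0 w o.-1).2) ->
  ((size x + o < size w)%N -> ~~ (nth letter0 w (size x + o)).2) ->
  string_mx k w z *m shift_mx (size w) (size x) o
    = shift_mx (size w) (size x) o *m string_mx k x z.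
Proof.
move=> ww wx sub lw rw; have [le_xw _] := sub.
apply/matrixP=> i j; rewrite mul_shift_mx mulmx_shift // !string_mxE //.
have lt_jo : (j + o < (size w).+1)%N by have := ltn_ord j; lia.
rewrite inordK // (@string_arrow_subword false x) ?leq_ord //; last first.
- by move=> /rw; case: (_.2).
- by move=> /lw ->.
case: ifP => //= /andP[oi ix].
by rewrite inordK //; lia.
Qed.

Lemma string_subword_quo x w o z : is_word w -> is_word x -> subword_at x w o ->
  ((0 < o)%N -> ~~ (nth letter0 w o.-1).2) ->
  ((size x + o < size w)%N -> (nth letter0 w (size x + o)).2) ->
  (shift_mx (size w) (size x) o)^T *m string_mx k w z
    = string_mx k x z *m (shift_mx (size w) (size x) o)^T.
Proof.
move=> ww wx sub lw rw; have [le_xw _] := sub.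
(* Transposition turns the projection into the inclusion and reverses the arrows. *)
apply: trmx_inj; rewrite !trmx_mul !trmxK.
have trE y a b : is_word y ->
    (string_mx k y z)^T a b = (string_arrow true y z a b)%:R.
  by move=> wy; rewrite [LHS]mxE string_mxE // /string_arrow orbC.
apply/matrixP=> i j; rewrite mul_shift_mx mulmx_shift // !trE //.
have lt_jo : (j + o < (size w).+1)%N by have := ltn_ord j; lia.
rewrite inordK // (@string_arrow_subword true x) ?leq_ord //; last first.
- by move=> /rw ->.
- by move=> /lw; case: (_.2).
by case: ifP => //= /andP[oi ix]; rewrite inordK //; lia.
Qed.

Lemma shift_mx_cover l1 l2 n : (n = l1 + l2)%N ->
  exists K1 K2, shift_mx n l1 0 *m K1 + shift_mx n l2 l1 *m K2 = 1%:M.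
Proof.
move=> ->; exists (\matrix_(i, j) (i == j :> nat)%:R).
(* Both inclusions hit the basis vector with index l1; [0 < i] counts it only once. *)
exists (\matrix_(i, j) ((i + l1 == j)%N && (0 < i)%N)%:R).
apply/matrixP=> i j; rewrite mxE !mul_shift_mx !addn0 subn0 !mxE.
have := ltn_ord i; have := ltn_ord j => ltj lti.
have [le_il1|lt_l1i] := leqP i l1.
  rewrite inordK // -val_eqE /=; case: ifP => [/andP[le_l1i _]|]; last by rewrite addr0.
  have -> : (i - l1 = 0)%N by lia.
  by rewrite inordK // andbF addr0.
rewrite (ltnW lt_l1i) (_ : (i <= l2 + l1)%N); last by lia.
rewrite andbF inordK; last by lia.
by rewrite /= subnK ?(ltnW lt_l1i) // subn_gt0 lt_l1i andbT add0r.
Qed.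

Variables (gT : finGroupType) (G : {group gT}) (g h : gT).
Hypothesis genG : <<[set g; h]>>%g = G.
Variables (d : nat) (N : mx_representation k G d).

Lemma is_word_cat x1 x2 : is_word (x1 ++ x2) -> is_word x1 /\ is_word x2.
Proof.
rewrite /is_word => w12.
by have := take_sorted (size x1) w12; have := drop_sorted (size x1) w12;
  rewrite drop_size_cat // take_size_cat.
Qed.

(** The two subwords share the basis vector with index [size x1]. If the last letter of [x1] is
    negative, this vector is a sink and both spans are submodules; otherwise it is a source and both
    are quotients. *)
Lemma string_split w x1 x2 (r : mx_representation k G (size w).+1) :
  w = x1 ++ x2 -> is_word w -> (0 < size x1)%N -> (0 < size x2)%N ->
  (last letter0 x1).2 != (head letter0 x2).2 ->
  XY_action g h r (string_mx k w) ->
  exists (r1 : mx_representation k G (size x1).+1)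
         (r2 : mx_representation k G (size x2).+1),
    [/\ XY_action g h r1 (string_mx k x1), XY_action g h r2 (string_mx k x2)
      & forall A, kills N r A <-> kills N r1 A /\ kills N r2 A].
Proof.
move=> def_w ww x1_gt0 x2_gt0 turn rA.
have [w1 w2] : is_word x1 /\ is_word x2 by apply: is_word_cat; rewrite -def_w.
have sw : size w = (size x1 + size x2)%N by rewrite def_w size_cat.
have sub1 : subword_at x1 w 0.
  by split=> [|t ltt]; rewrite addn0 ?sw ?leq_addr // def_w nth_cat ltt.
have sub2 : subword_at x2 w (size x1).
  split=> [|t ltt]; first by rewrite sw addnC.
  by rewrite def_w nth_cat ltnNge leq_addl addnK.
have [K1 [K2 cov]] := shift_mx_cover sw.
have [le1 _] := sub1; have [le2 _] := sub2.
have o1 b : (0 < 0)%N -> is_true b by [].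
have e2 b : (size x2 + size x1 < size w)%N -> is_true b by rewrite sw addnC ltnn.
have lastE : nth letter0 w (size x1).-1 = last letter0 x1.
  by rewrite def_w nth_cat ltn_predL x1_gt0 nth_last.
have headE : nth letter0 w (size x1 + 0) = head letter0 x2.
  by rewrite addn0 def_w nth_cat ltnn subnn nth0.
have [l1|/negbTE l1] := boolP (last letter0 x1).2.
  have J1 z := @string_subword_sub x1 w 0 z ww w1 sub1 (@o1 _)
    ltac:(by rewrite headE; move: turn; rewrite l1; case: (_.2)).
  have J2 z := @string_subword_sub x2 w (size x1) z ww w2 sub2
    ltac:(by rewrite lastE) (@e2 _).
  have [r1 [rA1 rJ1]] := subrepr genG rA (shift_mx_trK le1) J1.
  have [r2 [rA2 rJ2]] := subrepr genG rA (shift_mx_trK le2) J2.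
  exists r1, r2; split=> // A; split=> [kr|[kr1 kr2]]; last first.
    exact: kills_joint_quo rJ1 rJ2 cov kr1 kr2.
  split; [exact: (kills_sub rJ1 (shift_mx_trK le1) kr) |
          exact: (kills_sub rJ2 (shift_mx_trK le2) kr)].
have P1 z := @string_subword_quo x1 w 0 z ww w1 sub1 (@o1 _)
  ltac:(by rewrite headE; move: turn; rewrite l1; case: (_.2)).
have P2 z := @string_subword_quo x2 w (size x1) z ww w2 sub2
  ltac:(by rewrite lastE l1) (@e2 _).
have [r1 [rA1 rJ1]] := quorepr genG rA (shift_mx_trK le1) P1.
have [r2 [rA2 rJ2]] := quorepr genG rA (shift_mx_trK le2) P2.
have cov' : K1^T *m (shift_mx (size w) (size x1) 0)^T
   + K2^T *m (shift_mx (size w) (size x2) (size x1))^T = 1%:M.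
  by rewrite -!trmx_mul -linearD /= cov trmx1.
exists r1, r2; split=> // A; split=> [kr|[kr1 kr2]]; last first.
  exact: kills_joint_sub rJ1 rJ2 cov' kr1 kr2.
split; [exact: (kills_quo rJ1 (shift_mx_trK le1) kr) |
        exact: (kills_quo rJ2 (shift_mx_trK le2) kr)].
Qed.

End StringModules.

(** * Loewy length *)

Section Loewy.

Variables (k : fieldType) (gT : finGroupType) (G : {group gT}) (p : nat).
Hypotheses (charkp : p \in [pchar k]) (pG : (p.-group G)%g).

Local Notation kG := (group_ring k G).

Lemma trivial_mx_repr n : mx_repr G (fun _ => 1%:M : 'M[k]_n).
Proof. by split=> [|x y _ _] //; rewrite mulmx1. Qed.

Definition trivial_repr n := MxRepresentation (trivial_mx_repr n).

Definition augmentation (A : 'M[k]_#|G|) : k := gring_op (trivial_repr 1) A 0 0.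

Lemma augmentationE A : augmentation A = \sum_i gring_row A 0 i.
Proof.
rewrite /augmentation gring_op_sum summxE.
by apply: eq_bigr => i _; rewrite !mxE mulr1.
Qed.

Lemma rfix_gring_op n (r : mx_representation k G n) m (C : 'M_(m, n)) A :
  (forall x, x \in G -> C *m r x = C) -> C *m gring_op r A = augmentation A *: C.
Proof.
move=> fixC; rewrite gring_op_sum mulmx_sumr augmentationE scaler_suml.
by apply: eq_bigr => i _; rewrite -scalemxAr fixC ?enum_valP.
Qed.

(** The augmentation ideal [L] is a left ideal of codimension one, hence maximal, and the radical
    lies in every maximal left ideal. *)
Lemma in_rad_augmentation A : in_rad kG A -> augmentation A = 0.
Proof.
pose f := lin_mx (gring_op (trivial_repr 1)).
pose L := (kG :&: kermx f)%MS : 'A[k]_#|G|.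
have LP B : reflect ((B \in kG)%MS /\ augmentation B = 0) (B \in L)%MS.
  rewrite /L sub_capmx; apply: (iffP andP) => -[kB LB]; split=> //.
    move/sub_kermxP: LB; rewrite mul_vec_lin => /eqP.
    by rewrite mxvec_eq0 => /eqP LB; rewrite /augmentation LB mxE.
  have B0 : gring_op (trivial_repr 1) B = 0.
    by rewrite [LHS]mx11_scalar -/(augmentation B) LB -scalemx1 scale0r.
  apply/sub_kermxP; rewrite mul_vec_lin; apply/eqP; rewrite mxvec_eq0.
  exact/eqP.
case=> _ radA; suff maxL : maximal_left_ideal kG L by have /LP[] := radA L maxL.
have aug1 : augmentation 1%:M = 1 by rewrite /augmentation gring_op1 mxE.
split.
- exact: capmxSl.
- apply/mulsmx_subP=> B C kB /LP[kC C0]; apply/LP; split.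
    exact: envelop_mxM.
  by rewrite /augmentation gring_opM // mxE big_ord1 -!/(augmentation _) C0 mulr0.
- apply/negP=> kL; have /LP[_] := submx_trans (envelop_mx1 _) kL.
  by rewrite aug1 => /eqP; rewrite oner_eq0.
move=> L' L'k _ LL'; have [L'L|/memmx_subP nL'L] := boolP (L' <= L)%MS; first by left.
right.
have /existsNP[B /not_implyP[L'B nLB]] : ~ forall B, (B \in L')%MS -> (B \in L)%MS.
  by move=> L'L; apply: nL'L => B; apply: L'L.
have kB := submx_trans L'B L'k.
have B0 : augmentation B != 0 by apply/eqP=> B0; apply: nLB; apply/LP.
apply/memmx_subP=> C kC.
(* Codimension one made explicit: as [B] has non-zero augmentation, every [C] is a multiple of [B]
   plus an element of [L]. *)
rewrite -(subrK (augmentation C / augmentation B *: B) C) linearD addmx_sub //=.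
  apply: submx_trans LL'; apply/LP; split.
    by rewrite linearB linearZ addmx_sub ?eqmx_opp ?scalemx_sub.
  rewrite (_ : augmentation _
    = augmentation C - augmentation C / augmentation B * augmentation B).
    by rewrite divfK ?subrr.
  by rewrite /augmentation linearB linearZ !mxE.
by rewrite linearZ scalemx_sub.
Qed.

Lemma in_rad_pow_mem t A : in_rad_pow kG t A -> (A \in kG)%MS.
Proof.
elim: t A => // t IHt A /= [s [sr ->]].
rewrite linear_sum big_seq; apply: summx_sub => B /sr[[kB1 _] /IHt kB2].
exact: envelop_mxM.
Qed.

Lemma in_rad_powS t A : in_rad_pow kG t.+1 A -> in_rad_pow kG t A.
Proof.
elim: t A => [|t IHt] A; first exact: in_rad_pow_mem.
by case=> s [sr ->]; exists s; split=> // B /sr[? /IHt].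
Qed.

Section Nilpotency.

Variables (n : nat) (r : mx_representation k G n).

(** Operators act on rows from the right, the convention of [rfix_mx] and [factmod_repr]; whether a
    product of operators vanishes does not depend on the side. *)
Definition gring_ops m (C : 'M_(m, n)) := foldl (fun C A => C *m gring_op r A) C.

Lemma in_rad_pow_gring_ops t m (C : 'M_(m, n)) A : in_rad_pow kG t A ->
  (forall s, size s = t -> (forall B, B \in s -> augmentation B = 0) ->
     gring_ops C s = 0) ->
  C *m gring_op r A = 0.
Proof.
elim: t C A => [|t IHt] C A radA sC; first by rewrite [C](sC [::]) ?mul0mx.
case: radA => s [sr ->]; rewrite linear_sum /= mulmx_sumr big_seq big1 // => B.
case/sr=> rad1 rad2; rewrite gring_opM ?(in_rad_pow_mem rad2) // mulmxA.
apply: IHt rad2 _ => u szu u0; apply: (sC (B.1 :: u)); first by rewrite /= szu.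
by move=> D; rewrite inE => /predU1P[->|/u0//]; apply: in_rad_augmentation.
Qed.

End Nilpotency.

(** A p-group in characteristic p has non-zero fixed vectors [U] in every non-zero module. By
    induction on the dimension, [t] factors of augmentation 0 map everything into [U], and one more
    factor is zero on [U]. *)
Lemma gring_ops_nilpotent n (r : mx_representation k G n) :
  exists t, forall m (C : 'M_(m, n)) s, size s = t ->
    (forall B, B \in s -> augmentation B = 0) -> gring_ops r C s = 0.
Proof.
have [l] := ubnP n; elim: l => // l IHl in n r *; rewrite ltnS => le_nl.
have [n0|n_gt0] := posnP n.
  exists 0%N => m C [|//] _ _; apply/matrixP=> i j.
  by exfalso; have := leq_ltn_trans (leq0n _) (ltn_ord j); rewrite n0.
have modU := rfix_mx_module r; set U := rfix_mx r G in modU.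
have U0 : U != 0 by apply: (rfix_pgroup_pchar charkp _ n_gt0 pG).
have [|t tP] := IHl _ (factmod_repr modU).
  apply: leq_trans le_nl; rewrite mxrank_coker ltn_subrL n_gt0.
  by rewrite lt0n mxrank_eq0 U0.
exists t.+1 => m C s; case/lastP: s => // s A; rewrite size_rcons => -[sz_s] s0.
rewrite /gring_ops foldl_rcons -/(gring_ops _ _ _).
have factJ m' (D : 'M_(m', n)) B :
    in_factmod U (D *m gring_op r B)
      = in_factmod U D *m gring_op (factmod_repr modU) B.
  rewrite !gring_op_sum !mulmx_sumr linear_sum; apply: eq_bigr => i _.
  by rewrite -!scalemxAr linearZ /= in_factmodJ ?enum_valP.
have factsJ D u : in_factmod U (gring_ops r D u)
    = gring_ops (factmod_repr modU) (in_factmod U D) u :> 'M_(m, _).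
  by elim: u D => //= B u IHu D; rewrite IHu factJ.
have CU : (gring_ops r C s <= U)%MS.
  rewrite -in_factmod_eq0 factsJ tP // => B sB; apply: s0.
  by rewrite mem_rcons inE sB orbT.
rewrite rfix_gring_op; last by exact/rfix_mxP.
by rewrite s0 ?scale0r // mem_rcons inE eqxx.
Qed.

Lemma rad_pow_kills_eventually n (r : mx_representation k G n) :
  exists t, rad_pow_kills r t.
Proof.
have [t tP] := gring_ops_nilpotent r; exists t => A radA.
by rewrite -[LHS]mul1mx; apply: in_rad_pow_gring_ops radA _ => s; apply: tP.
Qed.

Lemma loewy_length_leq n (r : mx_representation k G n) t :
  (loewy_length r <= t)%N <-> rad_pow_kills r t.
Proof.
rewrite /loewy_length; case: pselect => [ex|[]]; last first.
  by have [t' rt'] := rad_pow_kills_eventually r; exists t'; apply/asboolP.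
case: ex_minnP => t0 /asboolP rt0 min_t0.
split=> [le_t|rt]; last by apply: min_t0; apply/asboolP.
move=> A radA; apply: rt0; rewrite -(subnK le_t) in radA.
by elim: (t - t0)%N radA => //= u IHu /in_rad_powS.
Qed.

Variables (d : nat) (N : mx_representation k G d).

(** A Loewy length is the least t for which the t-th radical power lies in the annihilator, and the
    annihilator on the left is the intersection of those on the right. *)
Lemma loewy_length_max n (r : mx_representation k G n) (I : finType) (C : {set I})
    (m : I -> nat) (rC : forall i, mx_representation k G (m i)) :
  (forall A, kills N r A <-> forall i, i \in C -> kills N (rC i) A) ->
  loewy_length (prod_repr r N)
    = (\max_(i in C) loewy_length (prod_repr (rC i) N))%N.
Proof.
move=> rC_kills; apply/eqP; rewrite eqn_leq; apply/andP; split.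
  apply/loewy_length_leq => A radA; apply/rC_kills => i Ci.
  move: A radA; apply/loewy_length_leq.
  by rewrite (bigD1 i Ci) leq_maxl.
apply/bigmax_leqP => i Ci; apply/loewy_length_leq => A radA.
have rA : kills N r A by move: A radA; apply/loewy_length_leq.
exact: (rC_kills A).1.
Qed.

End Loewy.

(** * Directed components *)

Section Components.

Local Notation letter0 := (false, false).

Implicit Types w u : seq letter.

Local Notation sgn w i := (nth letter0 w i).2.

Lemma directedP u :
  reflect (forall t, (t < size u)%N -> sgn u t = sgn u 0) (directed u).
Proof.
rewrite /directed; apply: (iffP orP) => [[]/(all_nthP letter0) u_s t lt_t|u_s].
- have u_t := u_s _ lt_t; have u_0 := u_s 0%N (leq_ltn_trans (leq0n _) lt_t).
  by rewrite (negbTE u_t) (negbTE u_0).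
- have u_t := u_s _ lt_t; have u_0 := u_s 0%N (leq_ltn_trans (leq0n _) lt_t).
  by rewrite u_t u_0.
case u0: (sgn u 0); [right | left]; apply/(all_nthP letter0) => t lt_t.
  by rewrite u_s.
by rewrite u_s // u0.
Qed.

Lemma nth_subword w a b t : (t < b - a)%N ->
  nth letter0 (drop a (take b w)) t = nth letter0 w (a + t).
Proof. by move=> lt_t; rewrite nth_drop nth_take //; lia. Qed.

Lemma size_subword w a b : (b <= size w)%N -> size (drop a (take b w)) = (b - a)%N.
Proof. by move=> leb; rewrite size_drop size_takel. Qed.

Lemma directed_subwordP w a b : (b <= size w)%N ->
  reflect (forall i, (a <= i < b)%N -> sgn w i = sgn w a)
    (directed (drop a (take b w))).
Proof.
move=> leb; apply: (iffP (directedP _)) => [dw i /andP[ai ib]|dw t].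
  have := dw (i - a)%N; rewrite size_subword // !nth_subword ?subnKC ?addn0 //.
  - by apply; lia.
  - lia.
  - lia.
by rewrite size_subword // => lt_t; rewrite !nth_subword ?addn0 ?dw; lia.
Qed.

(* The maximal directed occurrences a_(a+1) ... a_b of positive length. *)
Definition block w a b :=
  [/\ (a < b <= size w)%N, forall i, (a <= i < b)%N -> sgn w i = sgn w a,
      (0 < a)%N -> sgn w a.-1 != sgn w a & (b < size w)%N -> sgn w b != sgn w a].

(** One-letter enlargements suffice to test maximality: any larger directed occurrence contains the
    letter just before or just after (a, b). *)
Lemma componentP w (p : occurrence w) : (0 < size w)%N ->
  p \in directed_components w <-> block w p.1 p.2.
Proof.
case: p => a b w_gt0; rewrite inE /directed_occurrence /subword /=.
have dirP (c d : 'I_(size w).+1) := @directed_subwordP w c d (leq_ord d).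
split=> [/andP[/andP[le_ab /dirP dab] /forallP maxab]|].
  have ltb := leq_ord b.
  have maxP c d : (c <= a)%N -> (b <= d)%N -> (d <= size w)%N ->
      (forall i, (c <= i < d)%N -> sgn w i = sgn w c) -> c = a /\ d = b.
    move=> le_ca le_bd le_d dcd; have := maxab (inord c, inord d).
    rewrite /directed_occurrence /subword /= !inordK ?ltnS //; last by lia.
    rewrite le_ca le_bd (introT (directed_subwordP c le_d)) //= ?andbT.
    rewrite (leq_trans le_ca (leq_trans le_ab le_bd)) /= => /eqP[<- <-].
    by rewrite !inordK ?ltnS //; lia.
  (* An empty occurrence in a non-empty word can be enlarged by a letter on its right or, at the end
     of the word, on its left. *)
  have lt_ab : (a < b)%N.
    rewrite ltn_neqAle le_ab andbT; apply/eqP=> eq_ab.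
    have [lt_b|ge_b] := ltnP b (size w).
      have [||||_] := maxP a b.+1; rewrite ?leqnn //; last by lia.
      by move=> i; rewrite ltnS -eq_ab => i_a; have -> : i = a by lia.
    have [||||] := maxP a.-1 b; rewrite ?leqnn ?leq_pred //; last by lia.
    by move=> i; rewrite -eq_ab => i_a; have -> : i = a.-1 by lia.
  split; first by rewrite lt_ab.
  - exact: dab.
  - move=> a_gt0; apply/eqP=> sa.
    have [||||] := maxP a.-1 b; rewrite ?leqnn ?leq_pred //; last by lia.
    move=> i i_ab; have [->//|ne_i] := eqVneq i a.-1.
    by rewrite sa dab //; lia.
  - move=> lt_b; apply/eqP=> sb.
    have [||||_] := maxP a b.+1; rewrite ?leqnn //; last by lia.
    move=> i i_ab; have [->//|ne_i] := eqVneq i b.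
    by rewrite dab //; lia.
case=> /andP[lt_ab _] dab la rb.
rewrite (ltnW lt_ab) (introT (dirP a b)) //=.
apply/forallP => -[c d] /=; apply/implyP => /and3P[/andP[_ /dirP dcd] le_ca le_bd].
have le_d := leq_ord d.
have eq_ca : c = a :> nat.
  apply/eqP; rewrite eqn_leq le_ca leqNgt; apply/negP=> lt_ca.
  have := la (leq_ltn_trans (leq0n _) lt_ca).
  by rewrite (dcd a.-1) ?(dcd a) ?eqxx //; lia.
have eq_db : d = b :> nat.
  apply/eqP; rewrite eqn_leq le_bd andbT leqNgt; apply/negP=> lt_bd.
  have := rb (leq_trans lt_bd le_d).
  by rewrite (dcd b) ?(dcd a) ?eqxx //; lia.
by apply/eqP; congr (_, _); apply: val_inj.
Qed.

Lemma block_start w a : (a < size w)%N -> ((0 < a)%N -> sgn w a.-1 != sgn w a) ->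
  exists b, block w a b.
Proof.
move=> lt_a la.
pose P b := (a < b <= size w)%N
  && all (fun i => (a <= i < b)%N ==> (sgn w i == sgn w a)) (iota 0 (size w)).
have Pa : P a.+1.
  rewrite /P ltnSn lt_a; apply/allP=> i _; apply/implyP=> ia.
  by have -> : i = a by lia.
have leP b : P b -> (b <= size w)%N by case/andP=> /andP[].
case: (ex_maxnP (ex_intro P _ Pa) leP) => b /andP[ab /allP sb] maxb.
have sgnb i : (a <= i < b)%N -> sgn w i = sgn w a.
  move=> i_ab; apply/eqP; have := sb i; rewrite mem_iota i_ab; apply; lia.
exists b; split=> // lt_b; apply/eqP=> eq_b.
suff /maxb: P b.+1 by rewrite ltnn.
rewrite /P lt_b (ltnW _) ?andbT; last by case/andP: ab.
apply/allP=> i _; apply/implyP => i_ab; apply/eqP.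
by have [->//|ne_ib] := eqVneq i b; rewrite sgnb //; lia.
Qed.

Lemma block_inj w a b b' : block w a b -> block w a b' -> b = b'.
Proof.
wlog lt_bb' : b b' / (b < b')%N => [wlt|].
  by have [/wlt|/wlt wb'|//] := ltngtP b b'; [apply | move=> /[swap]/wb'/[apply]].
case=> /andP[ab _] _ _ rb [/andP[_ le_b'] sb' _ _].
by have := rb (leq_trans lt_bb' le_b'); rewrite sb' ?eqxx //; lia.
Qed.

Definition starts w : {set 'I_(size w)} :=
  [set a : 'I_(size w) | (a == 0%N :> nat) || (sgn w a.-1 != sgn w a)].

Lemma card_directed_components w : (0 < size w)%N ->
  #|directed_components w| = #|starts w|.
Proof.
move=> w_gt0.
have lt_start (p : occurrence w) : p \in directed_components w -> (p.1 < size w)%N.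
  by case/componentP=> // /andP[ab le_b] _ _ _; apply: leq_trans le_b.
(* A component is determined by its start. [insubd] only narrows the ordinal type; its default is
   not reached on components, which are non-empty. *)
rewrite -(@card_in_imset _ _
  (fun p : occurrence w => insubd (Ordinal w_gt0) (p.1 : nat))).
  congr #|pred_of_set _|; apply/setP=> a; apply/imsetP/idP => [[p p_comp ->]|].
    rewrite inE val_insubd lt_start //=; have [//|_ _ la _] := (componentP p w_gt0).1.
    by case: posnP => //= /la.
  rewrite inE => /orP start_a; have lt_a := ltn_ord a.
  have [b ab] := @block_start w a lt_a
    ltac:(by case: start_a => [/eqP ->|]).
  have [/andP[lt_ab le_b] _ _ _] := ab.
  exists (inord a, inord b).
    by apply/componentP=> //=; rewrite !inordK ?ltnS // ltnW.
  by apply: val_inj; rewrite val_insubd /= inordK ?lt_a // ltnS ltnW.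
move=> [a b] [a' b'] ab_c ab'_c.
have /= lt_a := lt_start _ ab_c; have /= lt_a' := lt_start _ ab'_c.
move/(congr1 val); rewrite !val_insubd /= lt_a lt_a' => /val_inj eq_aa'.
move: ab'_c; rewrite -eq_aa' => /(componentP _ w_gt0)/= ab'.
have /= ab := (componentP _ w_gt0).1 ab_c.
by congr (_, _); apply: val_inj; apply: block_inj ab ab'.
Qed.

(** Every start except 0 is a change of direction, and the last letter has the direction of the
    first exactly when the number of changes is even. *)
Lemma odd_starts w : (0 < size w)%N ->
  odd #|starts w| = (sgn w (size w).-1 == sgn w 0).
Proof.
move=> w_gt0.
have -> : #|starts w|
    = (\sum_(0 <= a < size w) ((a == 0) || (sgn w a.-1 != sgn w a)))%N.
  rewrite big_mkord -sum1dep_card big_mkcond /=.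
  by apply: eq_bigr => a _; case: (_ || _).
rewrite -{1}(prednK w_gt0); elim: (size w).-1 => [|n IHn].
  by rewrite big_nat1 !eqxx.
rewrite big_nat_recr //= oddD IHn /=.
by case: (sgn w n); case: (sgn w n.+1); case: (sgn w 0).
Qed.

End Components.

(** * Components of a string module *)

Section StringComponents.

Variables (k : fieldType) (gT : finGroupType) (G : {group gT}) (g h : gT).
Hypothesis genG : <<[set g; h]>>%g = G.
Variables (d : nat) (N : mx_representation k G d).

Local Notation letter0 := (false, false).
Local Notation sgn w i := (nth letter0 w i).2.

Lemma last_take w b : (0 < b <= size w)%N ->
  last letter0 (take b w) = nth letter0 w b.-1.
Proof.
by case/andP=> b_gt0 le_b; rewrite -nth_last size_takel // nth_take // ltn_predL.
Qed.

Lemma head_drop w b : head letter0 (drop b w) = nth letter0 w b.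
Proof. by rewrite -nth0 nth_drop addn0. Qed.

Lemma string_take w b (r : mx_representation k G (size w).+1) :
  is_word w -> (0 < b <= size w)%N -> ((b < size w)%N -> sgn w b.-1 != sgn w b) ->
  XY_action g h r (string_mx k w) ->
  exists2 s : mx_representation k G (size (take b w)).+1,
    XY_action g h s (string_mx k (take b w)) & forall A, kills N r A -> kills N s A.
Proof.
move=> ww /andP[b_gt0 le_b] turn rA.
have [->|ne_b] := eqVneq b (size w); first by rewrite take_size; exists r.
have lt_b : (b < size w)%N by rewrite ltn_neqAle ne_b.
have [||||s [s' [sA _ rs]]] :=
  @string_split k gT G g h genG d N w (take b w) (drop b w) r _ ww _ _ _ rA.
- by rewrite cat_take_drop.
- by rewrite size_takel.
- by rewrite size_drop subn_gt0.
- by rewrite last_take ?b_gt0 // head_drop turn.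
by exists s => // A /rs[].
Qed.

Lemma string_drop w b (r : mx_representation k G (size w).+1) :
  is_word w -> (b < size w)%N -> ((0 < b)%N -> sgn w b.-1 != sgn w b) ->
  XY_action g h r (string_mx k w) ->
  exists2 s : mx_representation k G (size (drop b w)).+1,
    XY_action g h s (string_mx k (drop b w)) & forall A, kills N r A -> kills N s A.
Proof.
move=> ww lt_b turn rA.
have [->|b_gt0] := posnP b; first by rewrite drop0; exists r.
have [||||s' [s [_ sA rs]]] :=
  @string_split k gT G g h genG d N w (take b w) (drop b w) r _ ww _ _ _ rA.
- by rewrite cat_take_drop.
- by rewrite size_takel // ltnW.
- by rewrite size_drop subn_gt0.
- by rewrite last_take ?b_gt0 1?ltnW // head_drop turn.
by exists s => // A /rs[].
Qed.

Lemma string_block w a b (r : mx_representation k G (size w).+1) :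
  is_word w -> block w a b -> XY_action g h r (string_mx k w) ->
  exists2 s : mx_representation k G (size (drop a (take b w))).+1,
    XY_action g h s (string_mx k (drop a (take b w)))
    & forall A, kills N r A -> kills N s A.
Proof.
move=> ww [/andP[lt_ab le_b] sab la rb] rA.
have [||s sA rs] := @string_take w b r ww _ _ rA.
- by rewrite le_b andbT; lia.
- by move=> /rb; rewrite eq_sym [sgn w b.-1]sab //; lia.
have [|||t tA st] := @string_drop (take b w) a s _ _ _ sA.
- exact: take_sorted.
- by rewrite size_takel.
- by move=> a_gt0; rewrite !nth_take ?la //; lia.
by exists t => // A /rs/st.
Qed.

(** The induction runs over suffixes of the fixed word [w] that begin at the start of a component,
    so that the pieces split off remain occurrences in [w]. *)
Lemma string_suffix_killed w a (r : mx_representation k G (size (drop a w)).+1) A :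
  is_word w -> (a < size w)%N -> ((0 < a)%N -> sgn w a.-1 != sgn w a) ->
  XY_action g h r (string_mx k (drop a w)) ->
  (forall p : occurrence w, p \in directed_components w ->
     forall s : mx_representation k G (size (subword p)).+1,
       XY_action g h s (string_mx k (subword p)) -> kills N s A) ->
  kills N r A.
Proof.
move=> ww + + + killA; have [l] := ubnP (size w - a).
elim: l a r => // l IHl a r le_l lt_a la rA.
have [b ab] := block_start lt_a la; have [/andP[lt_ab le_b] sab _ rb] := ab.
pose p : occurrence w := (inord a, inord b).
have p1 : p.1 = a :> nat by rewrite inordK // ltnS ltnW.
have p2 : p.2 = b :> nat by rewrite inordK // ltnS.
have pE : drop a (take b w) = subword p by rewrite /subword p1 p2.
have p_comp : p \in directed_components w.
  by apply/componentP; [apply: leq_ltn_trans lt_a | rewrite p1 p2].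
have killp (s : mx_representation k G (size (drop a (take b w))).+1) :
    XY_action g h s (string_mx k (drop a (take b w))) -> kills N s A.
  by move: s; rewrite pE => s; apply: killA.
have [eq_b|ne_b] := eqVneq b (size w).
  by move: killp; rewrite eq_b take_size; apply.
have lt_b : (b < size w)%N by rewrite ltn_neqAle ne_b.
have turn : sgn w b.-1 != sgn w b by rewrite [sgn w b.-1]sab 1?eq_sym ?rb //; lia.
have [|||||s [t [sA tA rst]]] :=
  @string_split k gT G g h genG d N _ (drop a (take b w)) (drop b w) r _ _ _ _ _ rA.
- rewrite -{1}(cat_take_drop b w) drop_cat size_takel // ifT //.
- exact: drop_sorted.
- by rewrite size_subword // subn_gt0.
- by rewrite size_drop subn_gt0.
- rewrite head_drop -nth_last size_subword // nth_subword; last by lia.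
  by rewrite (_ : (a + (b - a).-1 = b.-1)%N) //; lia.
apply/rst; split; first exact: killp.
by apply: IHl tA; [lia | | move=> _].
Qed.

Lemma string_killed w (r : mx_representation k G (size w).+1) A :
  is_word w -> XY_action g h r (string_mx k w) ->
  (forall p : occurrence w, p \in directed_components w ->
     forall s : mx_representation k G (size (subword p)).+1,
       XY_action g h s (string_mx k (subword p)) -> kills N s A) ->
  kills N r A.
Proof.
move=> ww rA killA; have [w0|w_gt0] := posnP (size w); last first.
  by have := @string_suffix_killed w 0; rewrite drop0; apply.
(* The empty word is its own only component. *)
case: w w0 ww r rA killA => // _ _ r rA killA; pose p : occurrence [::] := (ord0, ord0).
apply: (killA p) rA; rewrite inE; apply/andP; split=> //.
apply/forallP=> -[c e]; apply/implyP=> _.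
by apply/eqP; congr (_, _); apply: etrans (ord1 _) (esym (ord1 _)).
Qed.

Variable p : nat.
Hypotheses (charkp : p \in [pchar k]) (pG : (p.-group G)%g).

(** Common last step for strings and bands. The first premise supplies a module for each component;
    the second quantifies over all such modules, and [kills_XY] passes between them. *)
Lemma loewy_length_components w n (r : mx_representation k G n) :
  (forall p : occurrence w, p \in directed_components w ->
     exists2 s : mx_representation k G (size (subword p)).+1,
       XY_action g h s (string_mx k (subword p))
       & forall A, kills N r A -> kills N s A) ->
  (forall A, (forall p : occurrence w, p \in directed_components w ->
     forall s : mx_representation k G (size (subword p)).+1,
       XY_action g h s (string_mx k (subword p)) -> kills N s A) -> kills N r A) ->
  exists Mc : forall p : occurrence w,
      mx_representation k G (size (subword p)).+1,
    (forall p, p \in directed_components w ->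
       XY_action g h (Mc p) (string_mx k (subword p))) /\
    loewy_length (prod_repr r N) =
      (\max_(p in directed_components w) loewy_length (prod_repr (Mc p) N))%N.
Proof.
move=> lower upper.
have /fin_all_exists[Mc McP] (c : occurrence w) :
    exists s : mx_representation k G (size (subword c)).+1,
      c \in directed_components w ->
      XY_action g h s (string_mx k (subword c))
      /\ forall A, kills N r A -> kills N s A.
  have [/lower[s sA rs]|_] := boolP (c \in directed_components w).
    by exists s.
  (* An arbitrary value for occurrences that are not components. *)
  by exists (trivial_repr k G _).
exists Mc; split=> [c /McP[]//|].
apply: (loewy_length_max charkp pG) => A; split=> [rA c /McP[_]|McA]; first exact.
by apply: upper => c cc s sA; apply: kills_XY genG (McP c cc).1 sA (McA c cc).
Qed.

End StringComponents.

(** * Band modules *)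

Lemma succn_mod m r : (0 < r)%N ->
  (m.+1 %% r = if (m %% r).+1 == r then 0 else (m %% r).+1)%N.
Proof.
move=> r_gt0; rewrite -addn1 -modnDml addn1.
case: eqP => [->|ne_r]; first exact: modnn.
by rewrite modn_small // ltn_neqAle ltn_pmod // andbT; apply/eqP.
Qed.

Lemma mulmx_entry (F : fieldType) m n p (A : 'M[F]_(m, n)) (B : 'M_(n, p)) i j :
  (A *m B) i j = (A *m col j B) i 0.
Proof. by rewrite !mxE; apply: eq_bigr => t _; rewrite mxE. Qed.

Section BandModules.

Variables (k : fieldType) (w : seq letter) (n : nat) (phi : 'End('cV[k]_n)).
Hypotheses (r_gt1 : (1 < size w)%N) (phi_inj : lker phi = 0%VS).

Local Notation letter0 := (false, false).
Local Notation r := (size w).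
Local Notation V := 'cV[k]_#|band_index r n|.
Local Notation T := (band_shift r phi).
Local Notation psi := (phi^-1)%VF.

Let r_gt0 : (0 < r)%N := ltnW r_gt1.

Lemma phiK : cancel phi psi.
Proof. by apply: lker0_lfunK; rewrite phi_inj. Qed.

Lemma psiK : cancel psi phi.
Proof. by apply: lker0_lfunVK; rewrite phi_inj. Qed.

(** The vector x in the copy of k^n with index i modulo r. Natural numbers as indices let one run
    around the band without case distinctions. *)
Definition band_vec i (x : 'cV[k]_n) : V :=
  \col_(p < #|band_index r n|)
    (if (nat_of_ord (enum_val p).1 == i %% r)%N then x (enum_val p).2 0 else 0).

Lemma band_vec_is_linear i : linear (band_vec i).
Proof.
move=> c x y; apply/colP=> p; rewrite !mxE.
by case: ifP => _; rewrite ?mulr0 ?addr0 // !mxE.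
Qed.

HB.instance Definition _ i :=
  GRing.isLinear.Build k 'cV[k]_n V _ (band_vec i) (band_vec_is_linear i).

Lemma band_vec_mod i x : band_vec (i %% r) x = band_vec i x.
Proof. by apply/colP=> p; rewrite !mxE modn_mod. Qed.

Lemma band_vec_delta (p : 'I_#|band_index r n|) :
  band_vec (enum_val p).1 (delta_mx (enum_val p).2 0) = delta_mx p 0.
Proof.
apply/colP=> p'; rewrite !mxE modn_small // andbT val_eqE.
rewrite -(inj_eq enum_val_inj p') -pair_eqE /pair_eq /=.
by rewrite andbT; case: (_.1 == _.1).
Qed.

Definition band_proj i (v : V) : 'cV[k]_n :=
  \col_j v (enum_rank (Ordinal (ltn_pmod i r_gt0), j)) 0.

Lemma band_proj_is_linear i : linear (band_proj i).
Proof. by move=> c x y; apply/colP=> p; rewrite !mxE. Qed.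

HB.instance Definition _ i :=
  GRing.isLinear.Build k V 'cV[k]_n _ (band_proj i) (band_proj_is_linear i).

Lemma band_vecK i j x :
  band_proj i (band_vec j x) = if i == j %[mod r] then x else 0.
Proof. by apply/colP=> p; rewrite !mxE enum_rankK /=; case: ifP; rewrite ?mxE. Qed.

Lemma band_shift_vec i x :
  T *m band_vec i.+1 x = band_vec i (if (i %% r == 0)%N then phi x else x).
Proof.
apply/colP=> p.
transitivity (\sum_a \sum_j T p (enum_rank (a, j))
    * band_vec i.+1 x (enum_rank (a, j)) 0).
  rewrite [LHS]mxE (reindex _ (onW_bij _ (enum_rank_bij _))) pair_bigA /=.
  by apply: eq_bigr => -[].
set b := Ordinal (ltn_pmod i.+1 r_gt0).
rewrite (bigD1 b) //= [X in _ + X]big1 ?addr0 => [|a ne_ab]; last first.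
  apply: big1 => j _; rewrite [band_vec _ _ _ _]mxE enum_rankK /=.
  by rewrite -[_ == (_ %% _)%N]/(a == b) (negbTE ne_ab) mulr0.
rewrite [RHS]mxE; case Ep: (enum_val p) => [a j] /=.
have predb : ord_pred b = (i %% r)%N :> nat.
  rewrite /= succn_mod //; case: eqP => [ir|/eqP ne_r].
    by rewrite add0n modn_small ?ltn_predL //; lia.
  by rewrite addSn /= modnDr modn_mod.
have predE : (a == ord_pred b) = (a == (i %% r)%N :> nat) by rewrite -predb.
under eq_bigr => j' _.
  rewrite [band_vec _ _ _ _]mxE enum_rankK /= eqxx [T _ _]mxE Ep enum_rankK.
  rewrite predE; over.
case: eqP => _; last by apply: big1 => j' _; rewrite mul0r.
(* The index i + 1 reduces to 1 exactly when i reduces to 0; for r = 1 it would never reduce to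
   1. *)
have -> : (b == 1%N :> nat) = (i %% r == 0)%N.
  rewrite /= succn_mod //; have [e|_] := eqVneq (i %% r).+1 r; last by rewrite eqSS.
  by case: (i %% r)%N e => // e; move: r_gt1; rewrite -e.
case: ifP => _; last first.
  rewrite (bigD1 j) //= eqxx mul1r big1 ?addr0 // => j' /negbTE ne_j.
  by rewrite eq_sym ne_j mul0r.
have {2}-> : x = \sum_j' x j' 0 *: delta_mx j' 0.
  by rewrite {1}[x]matrix_sum_delta; apply: eq_bigr => j' _; rewrite big_ord1.
rewrite linear_sum summxE; apply: eq_bigr => j' _.
by rewrite linearZ mxE mulrC.
Qed.

(** [invmx] is an inverse only on units, so [band_mx] has its intended meaning by this lemma. [S]
    moves index i to i + 1 and undoes phi at i = 0. *)
Lemma band_shift_unit : T \in unitmx.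
Proof.
pose S : 'M_(#|band_index r n|) :=
  \matrix_(p < #|band_index r n|, p' < #|band_index r n|)
  band_vec (enum_val p').1.+1 (if (enum_val p').1 == 0%N :> nat
    then psi (delta_mx (enum_val p').2 0) else delta_mx (enum_val p').2 0) p 0.
suff TS : T *m S = 1%:M by case/mulmx1_unit: TS.
apply/matrixP=> p p'; rewrite mulmx_entry.
have -> : col p' S = band_vec (enum_val p').1.+1 (if (enum_val p').1 == 0%N :> nat
    then psi (delta_mx (enum_val p').2 0) else delta_mx (enum_val p').2 0).
  by apply/colP=> p1; rewrite !mxE.
rewrite band_shift_vec modn_small //.
by case: eqP => _; rewrite ?psiK band_vec_delta !mxE andbT.
Qed.

(* A vector of the copy of k^n with index i + 1, twisted by psi at each passage
   through index 0 so that T moves it to the vector with index i. *)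
Definition chain_vec i (y : 'cV[k]_n) : V := band_vec i.+1 (iter (i %/ r) psi y).

Lemma iter_psi_is_linear m : linear (iter m psi).
Proof. by move=> c x y; elim: m => //= m ->; rewrite linearP. Qed.

Lemma chain_vec_is_linear i : linear (chain_vec i).
Proof. by move=> c x y; rewrite /chain_vec iter_psi_is_linear linearP. Qed.

HB.instance Definition _ i :=
  GRing.isLinear.Build k 'cV[k]_n V _ (chain_vec i) (chain_vec_is_linear i).

Lemma band_shift_chain i y : T *m chain_vec i.+1 y = chain_vec i y.
Proof.
(* From i to i + 1 the exponent of psi grows exactly when r divides i + 1, and exactly there T
   contributes a phi. *)
rewrite /chain_vec band_shift_vec divnS // -[(_ %% _ == 0)%N]/(r %| i.+1)%N.
by case: (r %| i.+1)%N; rewrite //= psiK.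
Qed.

Lemma band_unshift_chain i y : invmx T *m chain_vec i y = chain_vec i.+1 y.
Proof. by rewrite -band_shift_chain mulmxA mulVmx ?mul1mx ?band_shift_unit. Qed.

Lemma iter_psi_inj m : injective (iter m psi).
Proof. by elim: m => // m IHm x y /(can_inj psiK)/IHm. Qed.

Lemma chain_vec_surj i x : exists y, band_vec i.+1 x = chain_vec i y.
Proof.
exists (iter (i %/ r) phi x); rewrite /chain_vec; congr band_vec.
by elim: (i %/ r)%N x => // m IHm x; rewrite iterSr iterS phiK.
Qed.

(** This is a_(i+1) with cyclic index. Hence [chain_vec i], which lies in the copy with index i + 1,
    sits between [cyc_letter i] and [cyc_letter i.+1]. *)
Definition cyc_letter i : letter := nth letter0 w (i %% r).

Lemma band_mx_vec z i x : band_mx w phi z *m band_vec i.+1 x =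
  if cyc_letter i == (z, false) then T *m band_vec i.+1 x
  else if cyc_letter i.+1 == (z, true) then invmx T *m band_vec i.+1 x else 0.
Proof.
have colE p p' : band_mx w phi z p p' * band_vec i.+1 x p' 0 =
    (if cyc_letter i == (z, false) then T p p'
     else if cyc_letter i.+1 == (z, true) then invmx T p p' else 0)
    * band_vec i.+1 x p' 0.
  rewrite [band_vec _ _ _ _]mxE; case: eqP => [ip|]; last by rewrite !mulr0.
  congr (_ * _); rewrite [LHS]mxE /= ip /letter_at /= /cyc_letter.
  (* The convention a_0 = a_r in [band_mx] is the wrap-around of [cyc_letter]. *)
  suff -> : (if (i.+1 %% r == 0)%N then r else i.+1 %% r)%N.-1 = (i %% r)%N by [].
  rewrite succn_mod //; have [e|//] := eqVneq (i %% r).+1 r.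
  exact: (congr1 predn (esym e)).
apply/colP=> p; rewrite [LHS]mxE (eq_bigr _ (fun p' _ => colE p p')).
case: ifP => _; first by rewrite [RHS]mxE.
case: ifP => _; first by rewrite [RHS]mxE.
by rewrite mxE big1 // => p' _; rewrite mul0r.
Qed.

Definition hook_mx s (u : seq letter) y : 'M[k]_(#|band_index r n|, (size u).+1) :=
  \matrix_(p, t) chain_vec (s + t) y p 0.

Lemma col_hook_mx s u y t : col t (hook_mx s u y) = chain_vec (s + t) y.
Proof. by apply/colP=> p; rewrite !mxE. Qed.

(** The letters around [u] direct the outer arrows towards the two end vectors, so nothing leaves
    the image of M(u). The map is a homomorphism even if it is not injective. *)
Lemma hook_mx_intertwine s (u : seq letter) y z :
  (forall t, (t < size u)%N -> nth letter0 u t = cyc_letter (s.+1 + t)) ->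
  (cyc_letter s).2 -> ~~ (cyc_letter (s.+1 + size u)).2 ->
  band_mx w phi z *m hook_mx s u y = hook_mx s u y *m string_mx k u z.
Proof.
move=> uE ls ru; apply/matrixP=> p t.
rewrite mulmx_entry col_hook_mx.
have pick (m : nat) (C : 'I_(size u).+1 -> k) :
    (forall t', C t' = (t' == m :> nat)%:R) -> (m <= size u)%N ->
    \sum_t' hook_mx s u y p t' * C t' = chain_vec (s + m) y p 0.
  move=> CE le_m; rewrite (bigD1 (inord m)) //= CE inordK // eqxx mulr1 mxE inordK //.
  rewrite big1 ?addr0 // => t' ne_t'; rewrite CE.
  case: eqP => [t'm|]; last by rewrite mulr0.
  by move: ne_t'; rewrite -t'm inord_val eqxx.
rewrite [RHS]mxE.
under eq_bigr do rewrite [string_mx _ _ _ _ _]mxE.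
rewrite band_mx_vec -/(chain_vec _ _) /letter_at.
have [t0|t_gt0] := posnP t.
  rewrite t0 addn0 /=.
  have -> : (cyc_letter s == (z, false)) = false.
    by apply/eqP=> e; move: ls; rewrite e.
  have [u0|u_gt0] := posnP (size u).
    rewrite /= big1 ?mxE => [|t' _]; last by rewrite mulr0.
    case: eqP => [e|_]; last by rewrite mxE.
    by move: ru; rewrite u0 addn0 e.
  rewrite /= uE // addn0.
  case: eqP => _; last by rewrite mxE big1 // => t' _; rewrite mulr0.
  by rewrite band_unshift_chain (pick 1%N) // addn1.
rewrite ?t_gt0 /= (uE t.-1); last by rewrite prednK // -ltnS ltn_ord.
have -> : (s.+1 + t.-1 = s + t)%N by lia.
case: eqP => _.
  rewrite (pick t.-1) //; last by rewrite (leq_trans (leq_pred _)) // -ltnS ltn_ord.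
  by rewrite -{1}(prednK t_gt0) addnS band_shift_chain.
have [lt_t|ge_t] := ltnP t (size u).
  rewrite /= uE // addSn.
  case: eqP => _; last by rewrite mxE big1 // => t' _; rewrite mulr0.
  by rewrite band_unshift_chain (pick t.+1) // addnS.
have tu : t = size u :> nat by apply/eqP; rewrite eqn_leq ge_t -ltnS ltn_ord.
rewrite /= big1 => [|t' _]; last by rewrite mulr0.
case: eqP => [e|_]; last by rewrite mxE.
by case/negP: ru; rewrite addSn -tu e.
Qed.

(** The vector 0 is included, so a non-eigenvector is non-zero. *)
Definition eigenvector y := exists c, phi y = c *: y.

(** Chain vectors in different copies of k^n are independent. Only the two ends can share a copy,
    namely when [u] has length r; there they are images of y and psi y under the same power of
    psi. *)
Lemma hook_mx_free s u y : (size u <= r)%N -> y != 0 ->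
  (size u = r -> ~ eigenvector y) ->
  exists J', J' *m hook_mx s u y = 1%:M.
Proof.
move=> le_ur y0 neigy; apply/row_fullP; rewrite /row_full -mxrank_tr.
apply: inj_row_free => c; rewrite -[c]trmxK -trmx_mul => /(canRL trmxK).
rewrite trmx0; set b := c^T => Jb; have -> : b = 0; last exact: trmx0.
have {}Jb : \sum_t b t 0 *: chain_vec (s + t) y = 0.
  rewrite -[RHS]Jb; apply/colP=> p; rewrite summxE [RHS]mxE; apply: eq_bigr => t _.
  by rewrite !mxE mulrC.
have chain0 i x : iter (i %/ r) psi x = 0 -> x = 0.
  move=> ix0; apply: (@iter_psi_inj (i %/ r)); rewrite ix0.
  by elim: (i %/ r)%N => //= m <-; rewrite linear0.
have projb (t0 : nat) : (t0 < r)%N ->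
    \sum_(t < (size u).+1 | (t0 == t %[mod r])%N)
      b t 0 *: iter ((s + t) %/ r) psi y = 0.
  move=> lt_t0; rewrite -[RHS](linear0 (band_proj (s.+1 + t0))) -Jb linear_sum /=.
  rewrite big_mkcond /=; apply: eq_bigr => t _.
  rewrite linearZ /= band_vecK -addSn eqn_modDl.
  by case: ifP => //; rewrite scaler0.
(* A coefficient whose chain vector is alone in its copy of k^n vanishes. *)
have bt0 (t0 : 'I_(size u).+1) :
    (t0 < r)%N -> (0 < t0)%N || (size u < r)%N -> b t0 0 = 0.
  move=> lt_t0 t0_r; have := projb t0 lt_t0; rewrite (bigD1 t0) //= big1 ?addr0.
    move/eqP; rewrite scaler_eq0 => /orP[/eqP//|/eqP/chain0 y_eq0].
    by rewrite y_eq0 eqxx in y0.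
  move=> t /andP[/eqP t_t0 ne_t]; move: ne_t; have := ltn_ord t.
  rewrite ltnS -val_eqE /= => le_t; move: t_t0; rewrite (modn_small lt_t0).
  have [lt_t|ge_t] := ltnP t r; first by rewrite modn_small // => ->; rewrite eqxx.
  have -> : t = r :> nat by lia.
  by rewrite modnn => t00; move: t0_r; rewrite t00 /=; lia.
have [lt_ur|ge_ur] := ltnP (size u) r.
  apply/colP=> t; rewrite [RHS]mxE bt0 ?lt_ur ?orbT //.
  by apply: leq_trans lt_ur; apply: ltn_ord.
have ur : size u = r by apply/eqP; rewrite eqn_leq le_ur.
have pair0 : b ord0 0 *: y + b ord_max 0 *: psi y = 0.
  apply: (@chain0 s); rewrite iter_psi_is_linear.
  have := projb 0%N r_gt0; rewrite (bigD1 ord0) //= (bigD1 ord_max) /=; last first.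
    by rewrite -val_eqE /= ur modnn mod0n eqxx -lt0n.
  rewrite big1 ?addr0 => [|t /andP[/andP[/eqP t_mod t_n0] t_nmax]]; last first.
    have lt_t : (t < r)%N.
      rewrite ltn_neqAle -{1}ur -ur -ltnS ltn_ord andbT.
      by apply: contraNneq t_nmax => e; apply/eqP/val_inj.
    by move: t_mod t_n0; rewrite mod0n modn_small // -val_eqE /= => <-; rewrite eqxx.
  have -> : iter ((s + size u) %/ r) psi y = iter (s %/ r) psi (psi y).
    by rewrite ur divnDr // divnn r_gt0 addn1 iterSr.
  rewrite addn0 => <-; congr (_ + _).
  rewrite -[b ord_max 0 *: psi y]addr0 iter_psi_is_linear.
  rewrite [iter _ _ 0](_ : _ = 0) ?addr0 //.
  by elim: (s %/ r)%N => //= m ->; rewrite linear0.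
(* Otherwise applying phi to [pair0] exhibits y as an eigenvector. *)
have b0 : b ord0 0 = 0.
  apply/eqP/negPn/negP => b0; apply: (neigy ur).
  exists (- (b ord_max 0 / b ord0 0)).
  have := congr1 phi pair0; rewrite linearP linearZ /= psiK linear0 => /eqP.
  rewrite addr_eq0 => /eqP e; rewrite -[LHS]scale1r -(mulVf b0) -scalerA e.
  by rewrite scalerN scalerA scaleNr mulrC.
have bmax : b ord_max 0 = 0.
  move: pair0; rewrite b0 scale0r add0r => /eqP; rewrite scaler_eq0.
  case/orP=> [/eqP//|/eqP py0]; case/eqP: y0.
  by rewrite -(psiK y) py0 linear0.
apply/colP=> t; rewrite [RHS]mxE.
have [->//|t_n0] := eqVneq t ord0; have [->//|t_nmax] := eqVneq t ord_max.
apply: bt0; last by rewrite lt0n [_ != _]t_n0.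
by rewrite -ur ltn_neqAle -ltnS ltn_ord andbT.
Qed.

End BandModules.

(** * Non-eigenvectors of an automorphism of k^n *)

Section Eigenvectors.

Variables (k : fieldType) (n : nat) (phi : 'End('cV[k]_n)).

Lemma eigenvectorZ c y : eigenvector phi y -> eigenvector phi (c *: y).
Proof. by case=> l yl; exists l; rewrite linearZ /= yl !scalerA mulrC. Qed.

(** If all vectors were eigenvectors, all subspaces would be stable, and a line together with a
    complement would decompose k^n. *)
Lemma indecomposable_noneigenvector :
  (1 < n)%N -> indecomposable_automorphism phi -> exists y, ~ eigenvector phi y.
Proof.
move=> n_gt1 [_ indec]; apply/not_existsP => eig; apply: indec.
have {}eig y : eigenvector phi y by apply: contrapT.
pose v : 'cV[k]_n := delta_mx (Ordinal (ltnW n_gt1)) 0.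
have stable (W : {vspace 'cV[k]_n}) : (phi @: W <= W)%VS.
  apply/subvP=> _ /memv_imgP[x Wx ->]; have [c ->] := eig x.
  exact: memvZ.
exists <[v]>%VS, (<[v]>^C)%VS; split; rewrite ?addv_complf ?capv_compl //.
have dim_v : \dim <[v]>%VS = 1%N.
  rewrite dim_vline (_ : v != 0) //; apply/eqP=> /matrixP/(_ (Ordinal (ltnW n_gt1)) 0).
  by rewrite !mxE !eqxx => /eqP; rewrite oner_eq0.
rewrite -!dimv_eq0 dimv_compl dim_v dimvf /dim /= muln1.
by split=> //; rewrite subn_eq0 -ltnNge.
Qed.

(* An eigenvector y becomes the difference of two non-eigenvectors; if y + y0 is
   an eigenvector for mu and y one for la, then la / mu is different from 0 and
   1, so that y + (la / mu) y0 is not an eigenvector. *)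
Lemma noneigenvector_shift y0 y : lker phi = 0%VS -> ~ eigenvector phi y0 ->
  exists c, ~ eigenvector phi (y + c *: y0).
Proof.
move=> phi_inj neig0.
have phi0 x : phi x = 0 -> x = 0.
  by move=> px; rewrite -(phiK phi_inj x) px linear0.
have [[la yla]|neigy] := pselect (eigenvector phi y); last first.
  by exists 0; rewrite scale0r addr0.
have [->|y_neq0] := eqVneq y 0; first by exists 1; rewrite scale1r add0r.
have [[mu yy0mu]|neigy1] := pselect (eigenvector phi (y + y0)); last first.
  by exists 1; rewrite scale1r.
have y0E : phi y0 = mu *: y0 + (mu - la) *: y.
  rewrite -[y0 in LHS](addKr y) linearD linearN /= yy0mu yla.
  by apply/colP=> i; rewrite !mxE; ring.
have mu_neq0 : mu != 0.
  apply/eqP=> mu0; apply: neig0; move: yy0mu; rewrite mu0 scale0r => /phi0/eqP.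
  rewrite addrC addr_eq0 => /eqP->; rewrite -scaleN1r; apply: eigenvectorZ.
  by exists la.
have la_neq0 : la != 0.
  by apply: contraNneq y_neq0 => la0; apply/eqP/phi0; rewrite yla la0 scale0r.
have la_neq_mu : mu - la != 0.
  by apply/eqP=> e; apply: neig0; exists mu; rewrite y0E e scale0r addr0.
exists (la / mu) => -[nu]; rewrite linearD linearZ /= yla y0E => e.
have {e} : (la + la / mu * (mu - la) - nu) *: y = (la / mu * (nu - mu)) *: y0.
  apply/colP=> i; have := congr1 (fun v : 'cV_n => v i 0) e; rewrite !mxE => ei.
  apply/eqP; rewrite -subr_eq0; move/eqP: ei; rewrite -subr_eq0 => /eqP <-.
  by apply/eqP; ring.
(* Since y is an eigenvector and y0 is not, y0 is no multiple of y, which forces nu = mu. The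
   coefficient of y is then -(mu - la)^2 / mu, which is non-zero. *)
move=> e; have nu_mu : nu = mu.
  apply/eqP; rewrite -subr_eq0; apply/negPn/negP=> nu_mu; apply: neig0.
  have c0 : la / mu * (nu - mu) != 0 by rewrite !mulf_neq0 ?invr_eq0.
  rewrite -[y0]scale1r -(mulVf c0) -scalerA -e scalerA; apply: eigenvectorZ.
  by exists la.
move: e; rewrite nu_mu subrr mulr0 scale0r => /eqP.
rewrite scaler_eq0 (negbTE y_neq0) orbF.
rewrite (_ : _ - mu = - ((mu - la) ^+ 2 / mu)); last by field.
by rewrite oppr_eq0 !mulf_eq0 invr_eq0 orbb (negbTE la_neq_mu) (negbTE mu_neq0).
Qed.

End Eigenvectors.

(** * Runs and hooks of the cyclic word *)

Section CyclicBlocks.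

Local Notation letter0 := (false, false).

Variable w : seq letter.

Local Notation r := (size w).
Local Notation cl := (cyc_letter w).

Hypotheses (w_gt0 : (0 < r)%N) (turn0 : (nth letter0 w r.-1).2 != (nth letter0 w 0).2).

Lemma cyc_letterD i : cl (i + r) = cl i.
Proof. by rewrite /cyc_letter modnDr. Qed.

Lemma cyc_letter_small i : (i < r)%N -> cl i = nth letter0 w i.
Proof. by move=> lt_i; rewrite /cyc_letter modn_small. Qed.

(** The generator underlying a letter depends only on the parity of its position, and since r is
    even this persists across the end of [w]. *)
Lemma cyc_letter_alternate i : is_word w -> ~~ odd r -> (cl i).1 != (cl i.+1).1.
Proof.
move=> /(sortedP letter0) ww even_r; rewrite /cyc_letter succn_mod //.
have altn t : (t < r)%N -> (nth letter0 w t).1 = odd t (+) (nth letter0 w 0).1.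
  elim: t => // t IHt lt_t; have := ww _ lt_t; rewrite (IHt (ltnW lt_t)) /=.
  by case: (odd t) (_.1) ((nth letter0 w 0).1) => -[] [].
have lt_i : (i %% r < r)%N by rewrite ltn_pmod.
have [e|ne_r] := eqVneq (i %% r).+1 r; last by apply: ww; rewrite ltn_neqAle ne_r.
have odd_i : odd (i %% r) by rewrite -[odd _]negbK -oddS e.
by rewrite altn // odd_i; case: (_.1).
Qed.

(* The maximal run of l letters of the same direction that starts after the
   letter with index i, in the cyclic word indexed from 0. *)
Definition cyc_block i l :=
  [/\ (0 < l <= r)%N, forall t, (t < l)%N -> (cl (i.+1 + t)).2 = (cl i.+1).2,
      (cl i).2 != (cl i.+1).2 & (cl (i.+1 + l)).2 != (cl i.+1).2].

(** [(a + r).-1] is the cyclic predecessor of a; plain [a.-1] would truncate at a = 0. *)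
Lemma pred_startE a : (a < r)%N ->
  cl (a + r).-1 = nth letter0 w (if a == 0%N then r.-1 else a.-1).
Proof.
move=> lt_a; have [->|a_gt0] := posnP a.
  by rewrite add0n cyc_letter_small // ltn_predL.
have -> : ((a + r).-1 = a.-1 + r)%N by rewrite -(prednK a_gt0).
by rewrite cyc_letterD cyc_letter_small ?(leq_ltn_trans (leq_pred a)).
Qed.

Lemma block_cyc_block a b : block w a b -> cyc_block (a + r).-1 (b - a).
Proof.
case=> /andP[lt_ab le_b] sab la rb; have lt_a := leq_trans lt_ab le_b.
have Si : ((a + r).-1.+1 = a + r)%N by lia.
have clE t : (a + t < r)%N -> cl ((a + r).-1.+1 + t) = nth letter0 w (a + t).
  by move=> lt_t; rewrite Si addnAC cyc_letterD cyc_letter_small.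
have cl0 : cl (a + r).-1.+1 = nth letter0 w a by rewrite -[_.+1]addn0 clE addn0.
split.
- by lia.
- by move=> t lt_t; rewrite clE ?cl0 ?sab //; lia.
- rewrite pred_startE // cl0; have [->|a_gt0] := posnP a; first by [].
  exact: la.
have [eq_b|ne_b] := eqVneq b r.
  have -> : ((a + r).-1.+1 + (b - a) = 0 + r + r)%N by lia.
  rewrite !cyc_letterD cyc_letter_small // cl0.
  by rewrite -(sab r.-1) 1?eq_sym //; lia.
have lt_b : (b < r)%N by rewrite ltn_neqAle ne_b.
by rewrite clE ?cl0 subnKC ?rb // ltnW.
Qed.

(** A run across the end of [w] would contain both its last and its first letter, against [turn0];
    hence a run is an occurrence in [w]. *)
Lemma cyc_block_component i l : cyc_block i l ->
  exists2 p : occurrence w, p \in directed_components w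
    & subword p = mkseq (fun t => cl (i.+1 + t)) l.
Proof.
case=> /andP[l_gt0 le_l] sl li ri; set a := (i.+1 %% r)%N.
have lt_a : (a < r)%N by rewrite ltn_pmod.
have le_al : (a + l <= r)%N.
  rewrite leqNgt; apply/negP=> gt_al; case/eqP: turn0.
  have mod_i t : ((i.+1 + t) %% r = (a + t) %% r)%N by rewrite modnDml.
  have := sl (r - a)%N; have := sl (r - a).-1; rewrite /cyc_letter !mod_i.
  have -> : (a + (r - a) = r)%N by lia.
  have -> : (a + (r - a).-1 = r.-1)%N by lia.
  rewrite modnn modn_small ?ltn_predL // => -> //; last by lia.
  by move=> ->; lia.
have clE t : (a + t < r)%N -> cl (i.+1 + t) = nth letter0 w (a + t).
  by move=> lt_t; rewrite /cyc_letter -modnDml -/a modn_small.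
have cl0 : cl i.+1 = nth letter0 w a by rewrite -[i.+1]addn0 clE addn0.
have lt_al : (a < a + l)%N by rewrite -{1}[a]addn0 ltn_add2l.
pose p : occurrence w := (inord a, inord (a + l)).
have p1 : p.1 = a :> nat by rewrite inordK // ltnS ltnW.
have p2 : p.2 = (a + l)%N :> nat by rewrite inordK // ltnS.
exists p.
  apply/componentP=> //; rewrite p1 p2; split; first by rewrite lt_al.
  - move=> t /andP[le_at lt_t]; rewrite -cl0 -(sl (t - a)%N); last by lia.
    by rewrite clE subnKC //; lia.
  - move=> a_gt0; suff ai : (i %% r = a.-1)%N.
      by move: li; rewrite cl0 [cl i]/cyc_letter ai.
    by move: a_gt0; rewrite /a succn_mod //; have [|] := eqVneq.
  - by move=> lt_r; move: ri; rewrite cl0 clE.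
apply: (@eq_from_nth _ letter0); rewrite /subword p1 p2 size_subword // ?size_mkseq.
  by lia.
by move=> t lt_t; rewrite nth_subword // nth_mkseq ?clE //; lia.
Qed.

(* A hook is the shape of the submodule generated by a basis vector of the band
   module that is not in the image of X or Y: its lu left neighbours and its lv
   right neighbours are the images of the generator under words in X and Y. *)
Definition hook s lu lv :=
  [/\ cyc_block s lu, cyc_block (s + lu) lv, ~~ (cl s.+1).2,
      (cl (s + lu).+1).2 & (lu + lv <= r)%N].

(** At a valley [chain_vec i] is a sink, reached by the arrows of both adjacent letters. A hook
    extends from one valley to the next. *)
Definition valley i := (cl i).2 && ~~ (cl i.+1).2.

Lemma valley_exists a b : (a <= b)%N -> (cl a).2 -> ~~ (cl b).2 ->
  exists2 v, (a <= v < b)%N & valley v.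
Proof.
move=> le_ab sa; rewrite -(subnKC le_ab); elim: (b - a)%N => [|l IHl].
  by rewrite addn0 sa.
have [/IHl[v /andP[av vl] vv] _|] := boolP (~~ (cl (a + l)).2).
  by exists v => //; rewrite av addnS ltnS ltnW.
rewrite negbK addnS => sl nsl; exists (a + l)%N; last by rewrite /valley sl.
by rewrite leq_addr ltnSn.
Qed.

Lemma valleyD v : valley (v + r) = valley v.
Proof. by rewrite /valley -addSn !cyc_letterD. Qed.

(** Let [s] be the last valley up to i, [e] the next valley and [m] the first negative letter after
    [s]. Without a valley strictly between [s] and [e], the letters stay negative from [m] to [e],
    so the hook has sides m - s - 1 and e + 1 - m. *)
Lemma hook_cover i : (exists2 v, (v <= i)%N & valley v) ->
  exists s lu lv, hook s lu lv /\ (s <= i < s + lu + lv)%N.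
Proof.
case=> v le_vi val_v; pose P v := (v <= i)%N && valley v.
have exP : exists v, P v by exists v; rewrite /P le_vi.
have leP u : P u -> (u <= i)%N by case/andP.
case: (ex_maxnP exP leP) => s /andP[le_si val_s] max_s.
pose Q e := (s < e)%N && valley e.
(* By periodicity the next valley is at most r away, which bounds the length of the hook. *)
have Qr : Q (s + r)%N by rewrite /Q valleyD val_s andbT -{1}[s]addn0 ltn_add2l.
case: (ex_minnP (ex_intro Q _ Qr)) => e /andP[lt_se val_e] min_e.
have le_er := min_e _ Qr.
have lt_ie : (i < e)%N.
  rewrite ltnNge; apply/negP=> le_ei; have := max_s e; rewrite /P le_ei val_e.
  by move=> /(_ isT); rewrite leqNgt lt_se.
have noval t : (s < t < e)%N -> ~~ valley t.
  move=> /andP[lt_st lt_te]; apply/negP=> vt; have := min_e t.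
  by rewrite /Q lt_st vt leqNgt lt_te => /(_ isT).
have [sS s1] := andP val_s; have [sE e1] := andP val_e.
pose U m := (s.+1 <= m)%N && (cl m).2.
have Ue : U e by rewrite /U lt_se.
case: (ex_minnP (ex_intro U _ Ue)) => m /andP[lt_sm sm] min_m.
have le_me := min_m _ Ue.
have lt_s1m : (s.+1 < m)%N.
  by rewrite ltn_neqAle lt_sm andbT; apply: contraNneq s1 => ->.
have pos t : (s < t < m)%N -> (cl t).2 = false.
  move=> /andP[lt_st lt_tm]; apply/negbTE/negP=> st; have := min_m t.
  by rewrite /U lt_st st leqNgt lt_tm => /(_ isT).
have neg t : (m + t <= e)%N -> (cl (m + t)).2.
  elim: t => [|t IHt] le_t; first by rewrite addn0.
  have lt_mt : (m + t < e)%N by rewrite -addnS.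
  have := noval (m + t)%N; rewrite /valley (IHt (ltnW lt_mt)) addnS /= negbK; apply.
  by rewrite lt_mt andbT (leq_trans lt_sm) ?leq_addr.
have [mP le_m lt_i] : [/\ (s + (m - s.+1) = m.-1)%N, (0 < m - s.+1 <= r)%N
    & (s <= i < m.-1 + (e.+1 - m))%N].
  by clear - lt_sm le_me lt_s1m le_si lt_ie le_er; split; lia.
have [mS le_em le_l] : [/\ m.-1.+1 = m, (0 < e.+1 - m <= r)%N
    & (m - s.+1 + (e.+1 - m) <= r)%N].
  by clear - lt_sm le_me lt_s1m lt_se le_er; split; lia.
have pm : (cl m.-1).2 = false.
  by apply: pos; clear - lt_s1m; lia.
exists s, (m - s.+1)%N, (e.+1 - m)%N; rewrite /hook mP; split=> //.
split; rewrite ?mS //.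
  split; rewrite ?(negbTE s1) //.
  - by move=> t lt_t; apply: pos; clear - lt_t; lia.
  - by rewrite sS.
  - by rewrite subnKC // sm.
split; rewrite ?mS ?sm ?pm //.
  by move=> t lt_t; apply: neg; clear - lt_t; lia.
by rewrite subnKC ?(negbTE e1) // ltnW // ltnS.
Qed.

Section Hook.

Variables s lu lv : nat.
Hypothesis hk : hook s lu lv.

Lemma hook_signs :
  [/\ (cl s).2, forall j, (s < j <= s + lu)%N -> (cl j).2 = false,
      forall j, (s + lu < j <= s + lu + lv)%N -> (cl j).2
    & (cl (s + lu + lv).+1).2 = false].
Proof.
case: hk => -[_ p1 sl _] [_ p2 _ rl] s1 s2 _; split.
- by move: sl; rewrite (negbTE s1); case: (_.2).
- move=> j lt_j; have := p1 (j - s.+1)%N; rewrite (negbTE s1).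
  by rewrite subnKC; [apply |]; clear - lt_j; lia.
- move=> j lt_j; have := p2 (j - (s + lu).+1)%N; rewrite s2.
  by rewrite subnKC; [apply |]; clear - lt_j; lia.
by move: rl; rewrite s2 addSn; case: (_.2).
Qed.

(** Within a hook the direction turns from negative to positive only at its left end s. *)
Lemma hook_positive_block i l : cyc_block i l -> ~~ (cl i.+1).2 ->
  (s <= i < s + lu + lv)%N -> s = i /\ lu = l.
Proof.
have [cs pos neg _] := hook_signs; case: (hk) => _ _ _ s2 _.
case=> _ blk li ri si /andP[le_si lt_i].
have eq_si : s = i.
  apply/eqP; rewrite eqn_leq le_si leqNgt; apply/negP=> lt_si.
  have [le_i|lt_lui] := leqP i (s + lu).
    by move: li; rewrite pos ?lt_si // (negbTE si).
  by move: si; rewrite neg // ltnS ltnW // lt_i.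
split=> //; move: blk ri; rewrite -eq_si (negbTE (_ : ~~ (cl s.+1).2)) ?eq_si //.
rewrite -eq_si => blk ri; have [lt_l|lt_l|//] := ltngtP lu l.
  by have := blk _ lt_l; rewrite addSn s2.
by move: ri; rewrite addSn pos //; clear - lt_l; lia.
Qed.

Lemma hook_negative_block i l : cyc_block i l -> (cl i.+1).2 ->
  (s <= i < s + lu + lv)%N -> (s + lu)%N = i /\ lv = l.
Proof.
have [cs pos neg re] := hook_signs.
case=> _ blk li ri si /andP[le_si lt_i].
have ci : (cl i).2 = false by move: li; rewrite si; case: (_.2).
have lt_si : (s < i)%N.
  by rewrite ltn_neqAle le_si andbT; apply/eqP=> e; rewrite -e cs in ci.
have eq_i : (s + lu)%N = i.
  apply/eqP; rewrite eqn_leq; apply/andP; split; rewrite leqNgt; apply/negP=> lt_lu.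
    by move: si; rewrite pos // ltnS ltnW.
  by move: ci; rewrite neg // lt_lu ltnW.
split=> //; move: blk ri; rewrite si => blk ri.
have [lt_l|lt_l|//] := ltngtP lv l.
  by have := blk _ lt_l; rewrite addSn -eq_i re.
by move: ri; rewrite addSn -eq_i neg //; clear - lt_l; lia.
Qed.

(** A hook of length r reads the cyclic word exactly once, so a component can start only after its
    left end or after its peak. *)
Lemma card_components_hook : (lu + lv)%N = r -> (#|directed_components w| <= 2)%N.
Proof.
move=> l_r; rewrite card_directed_components //.
have [cs pos neg re] := hook_signs.
have in_r m : (m %% r < r)%N by rewrite ltn_pmod.
pose x m := Ordinal (in_r m).
apply: (@leq_trans #|[set x s.+1; x (s + lu).+1]|); last first.
  by rewrite cards2; case: (_ != _).
apply: subset_leq_card; apply/subsetP=> a; rewrite inE => start_a.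
(* The cyclic distance from s + 1 to a; the multiple of r prevents truncated subtraction. *)
pose t := ((a + r * s.+1 - s.+1) %% r)%N.
have lt_t : (t < r)%N by rewrite ltn_pmod.
have at_r : a = ((s.+1 + t) %% r)%N :> nat.
  rewrite modnDmr subnKC; last by rewrite (leq_trans _ (leq_addl _ _)) // leq_pmull.
  by rewrite [(r * _)%N]mulnC addnC modnMDl modn_small.
have sgn_a : (cl (s.+1 + t)).2 = (nth letter0 w a).2.
  by rewrite /cyc_letter -at_r.
have turn_a : (cl (s + t)).2 != (nth letter0 w a).2.
  have -> : cl (s + t) = cl (a + r).-1.
    rewrite /cyc_letter; congr nth; apply/eqP; rewrite -(eqn_modDr 1) !addn1 -addSn.
    by rewrite prednK ?addn_gt0 ?w_gt0 ?orbT // modnDr at_r modn_mod.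
  by rewrite pred_startE //; case: posnP start_a => [->|].
rewrite !inE -!val_eqE /= at_r.
have [->|t_gt0] := posnP t; first by rewrite addn0 eqxx.
suff -> : t = lu by rewrite addSn eqxx orbT.
move: turn_a; rewrite -sgn_a addSn.
have [lt_lu|lt_lu|//] := ltngtP t lu.
  by rewrite !pos //; clear - t_gt0 lt_lu; lia.
by rewrite !neg //; clear - lt_lu lt_t l_r; lia.
Qed.

End Hook.

Lemma block_hook a b : block w a b ->
  exists s lu lv, hook s lu lv /\
    (drop a (take b w) = mkseq (fun t => cl (s.+1 + t)) lu
     \/ drop a (take b w) = mkseq (fun t => cl ((s + lu).+1 + t)) lv).
Proof.
move=> ab; have blk := block_cyc_block ab; have [/andP[lt_ab le_b] _ _ _] := ab.
set i := (a + r).-1 in blk.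
have iS : i.+1 = (a + r)%N by rewrite prednK // addn_gt0 w_gt0 orbT.
have wE : drop a (take b w) = mkseq (fun t => cl (i.+1 + t)) (b - a).
  apply: (@eq_from_nth _ letter0); rewrite size_subword // ?size_mkseq // => t lt_t.
  rewrite nth_subword // nth_mkseq // iS addnAC cyc_letterD cyc_letter_small //; lia.
have [si|si] := boolP (cl i.+1).2.
  have [|s [lu [lv [hk si_s]]]] := @hook_cover i.
    (* The letter a is negative and the letter i, just before the next copy of the run, is positive,
       so a valley lies in between. *)
    have [|||v /andP[_ lt_v] vv] := @valley_exists a i.
    - by rewrite -ltnS iS -{1}[a]addn0 ltn_add2l.
    - by rewrite -cyc_letterD -iS.
    - by case: blk => _ _; rewrite si; case: (cl i).2.
    by exists v => //; apply: ltnW.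
  have [e1 e2] := hook_negative_block hk blk si si_s.
  by exists s, lu, lv; split=> //; right; rewrite e1 e2.
have [|s [lu [lv [hk si_s]]]] := @hook_cover i.
  exists i => //; rewrite /valley si andbT.
  by case: blk => _ _; rewrite (negbTE si); case: (cl i).2.
have [e1 e2] := hook_positive_block hk blk si si_s.
by exists s, lu, lv; split=> //; left; rewrite e1 e2.
Qed.

End CyclicBlocks.

(** * Components of a band module *)

Section BandComponents.

Variables (k : fieldType) (gT : finGroupType) (G : {group gT}) (g h : gT).
Hypothesis genG : <<[set g; h]>>%g = G.
Variables (d : nat) (N : mx_representation k G d).
Variables (w : seq letter) (n : nat) (phi : 'End('cV[k]_n)).
Variable M : mx_representation k G #|band_index (size w) n|.

Local Notation letter0 := (false, false).
Local Notation r := (size w).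
Local Notation cl := (cyc_letter w).

Hypotheses (ww : is_word w) (w_gt0 : (0 < r)%N) (even_r : ~~ odd r).
Hypotheses (n_gt0 : (0 < n)%N) (indec : indecomposable_automorphism phi).
Hypothesis rA : XY_action g h M (band_mx w phi).
Hypothesis even_comp : ~~ odd #|directed_components w|.
Hypothesis comp_n : (2 < #|directed_components w|)%N || (1 < n)%N.

Let r_gt1 : (1 < r)%N.
Proof. by case: (r) w_gt0 even_r => [|[|]]. Qed.

Let phi_inj : lker phi = 0%VS := indec.1.

Let turn0 : (nth letter0 w r.-1).2 != (nth letter0 w 0).2.
Proof. by move: even_comp; rewrite card_directed_components // odd_starts. Qed.

Definition hook_left s lu := mkseq (fun t => cl (s.+1 + t)) lu.
Definition hook_right s lu lv := mkseq (fun t => cl ((s + lu).+1 + t)) lv.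

(** The string module of the whole hook is embedded in M, which gives it a kG-structure, and is then
    split at its peak. The last clause says that its image in M is annihilated as soon as both
    halves are. *)
Lemma hook_embed s lu lv y : hook w s lu lv -> y != 0 ->
  ((lu + lv)%N = r -> ~ eigenvector phi y) ->
  exists (r1 : mx_representation k G (size (hook_left s lu)).+1)
         (r2 : mx_representation k G (size (hook_right s lu lv)).+1),
    [/\ XY_action g h r1 (string_mx k (hook_left s lu)),
        XY_action g h r2 (string_mx k (hook_right s lu lv)),
        forall A, kills N M A -> kills N r1 A /\ kills N r2 A
      & forall A, kills N r1 A -> kills N r2 A ->
          forall t, (t <= lu + lv)%N -> killed N M A (chain_vec w phi (s + t) y)].
Proof.
move=> hk y0 neigy; have [cs pos neg re] := hook_signs hk.
have [[/andP[lu_gt0 _] _ _ _] [/andP[lv_gt0 _] _ _ _] _ s2 le_r] := hk.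
pose u := hook_left s lu ++ hook_right s lu lv.
have sz_u : size u = (lu + lv)%N by rewrite size_cat !size_mkseq.
have uE t : (t < size u)%N -> nth letter0 u t = cl (s.+1 + t).
  rewrite sz_u => lt_t; rewrite nth_cat size_mkseq; case: ltnP => [lt_lu|le_lu].
    by rewrite nth_mkseq.
  rewrite nth_mkseq; last by rewrite ltn_subLR.
  by rewrite -addSn -addnA subnKC.
have wu : is_word u.
  apply/(sortedP letter0) => t lt_t; rewrite !uE //; last exact: ltnW.
  by rewrite addnS cyc_letter_alternate.
have [J' JK] := @hook_mx_free k w n phi r_gt1 phi_inj s u y
  ltac:(by rewrite sz_u) y0 ltac:(by rewrite sz_u).
have JA z := @hook_mx_intertwine k w n phi r_gt1 phi_inj s u y z uE cs
  ltac:(by rewrite sz_u addSn addnA re).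
have [R [RA RJ]] := subrepr genG rA JK JA.
have [|||r1 [r2 [r1A r2A rr]]] :=
  @string_split k gT G g h genG d N u (hook_left s lu) (hook_right s lu lv) R
    erefl wu _ _ _ RA.
- by rewrite size_mkseq.
- by rewrite size_mkseq.
- rewrite -nth_last size_mkseq nth_mkseq ?ltn_predL // -nth0 nth_mkseq // addn0 s2.
  by rewrite addSnnS prednK // pos // leqnn andbT -{1}[s]addn0 ltn_add2l.
exists r1, r2; split=> // A; first by move/(kills_sub RJ JK)/rr.
move=> k1 k2 t le_t; have RK : kills N R A by apply/rr.
have lt_t : (t < (size u).+1)%N by rewrite sz_u.
rewrite -(@col_hook_mx k w n phi s u y (Ordinal lt_t)) colE.
exact/killedM/(kills_killed_image RJ RK).
Qed.

Lemma hook_nonscalar s lu lv : hook w s lu lv -> (lu + lv)%N = r ->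
  exists y, ~ eigenvector phi y.
Proof.
move=> hk l_r; apply: indecomposable_noneigenvector indec.
by move: comp_n; rewrite ltnNge (card_components_hook w_gt0 turn0 hk l_r).
Qed.

Lemma noneigenvector_neq0 y : ~ eigenvector phi y -> y != 0.
Proof.
move=> neigy; apply/eqP=> y0; apply: neigy.
by exists 0; rewrite y0 linear0 scale0r.
Qed.

Lemma hook_vector s lu lv : hook w s lu lv ->
  exists2 y, y != 0 & ((lu + lv)%N = r -> ~ eigenvector phi y).
Proof.
move=> hk; have [l_r|ne_r] := eqVneq (lu + lv)%N r.
  have [y neigy] := hook_nonscalar hk l_r.
  by exists y; first exact: noneigenvector_neq0.
exists (delta_mx (Ordinal n_gt0) 0) => //; last by move/eqP: ne_r.
apply/eqP=> /matrixP/(_ (Ordinal n_gt0) 0); rewrite !mxE !eqxx => /eqP.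
by rewrite oner_eq0.
Qed.

Lemma band_component (p : occurrence w) : p \in directed_components w ->
  exists2 s : mx_representation k G (size (subword p)).+1,
    XY_action g h s (string_mx k (subword p)) & forall A, kills N M A -> kills N s A.
Proof.
move=> /componentP-/(_ w_gt0)/(block_hook w_gt0 turn0)[s [lu [lv [hk pE]]]].
have [y y0 neigy] := hook_vector hk.
have [r1 [r2 [r1A r2A Mr _]]] := hook_embed hk y0 neigy.
by rewrite /subword; case: pE => ->; [exists r1 | exists r2] => // A /Mr[].
Qed.

Lemma band_killed A :
  (forall p : occurrence w, p \in directed_components w ->
     forall s : mx_representation k G (size (subword p)).+1,
       XY_action g h s (string_mx k (subword p)) -> kills N s A) ->
  kills N M A.
Proof.
move=> killA.
have killcyc i l : cyc_block w i l ->
    forall s : mx_representation k G (size (mkseq (fun t => cl (i.+1 + t)) l)).+1,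
    XY_action g h s (string_mx k (mkseq (fun t => cl (i.+1 + t)) l)) -> kills N s A.
  by move=> /(cyc_block_component w_gt0 turn0)[p /killA + <-]; apply.
have valley0 : exists2 v, (v <= r.-1)%N & valley w v.
  have turn : (cl r.-1).2 != (cl 0).2 by rewrite !cyc_letter_small // ltn_predL.
  have [s0|s0] := boolP (cl 0).2.
    have [|||v /andP[_ lt_v] vv] := @valley_exists w 0 r.-1 => //.
      by move: turn; rewrite s0; case: (_.2).
    by exists v => //; apply: ltnW.
  exists r.-1 => //; rewrite /valley prednK // [cl r](cyc_letterD w 0).
  by rewrite s0 andbT; move: turn; rewrite (negbTE s0); case: (_.2).
apply: killed_cols => p; rewrite -band_vec_delta.
set i := (enum_val p).1; set x := delta_mx _ _.
(* The index is raised by r so that the valley of [valley0] lies at or before it, as [hook_cover]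
   requires. *)
rewrite -band_vec_mod -(modnDr i) band_vec_mod.
have iS : (i + r = (i + r.-1).+1)%N by rewrite -addnS prednK.
rewrite iS; have [y ->] := chain_vec_surj w phi_inj (i + r.-1)%N x.
have [|s [lu [lv [hk /andP[le_s lt_e]]]]] := @hook_cover w w_gt0 (i + r.-1)%N.
  by have [v le_v vv] := valley0; exists v => //; apply: leq_trans le_v (leq_addl _ _).
have good y' : y' != 0 -> ((lu + lv)%N = r -> ~ eigenvector phi y') ->
    killed N M A (chain_vec w phi (i + r.-1)%N y').
  move=> y0 neigy; have [r1 [r2 [r1A r2A _ rM]]] := hook_embed hk y0 neigy.
  have [blk1 blk2 _ _ _] := hk.
  rewrite -(subnKC le_s).
  apply: rM (killcyc _ _ blk1 _ r1A) (killcyc _ _ blk2 _ r2A) _ _.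
  by rewrite leq_subLR addnA ltnW.
have [l_r|/eqP ne_r] := eqVneq (lu + lv)%N r; last first.
  have [->|y0] := eqVneq y 0; first by rewrite linear0; apply: killed0.
  exact: good.
have [y0 neig0] := hook_nonscalar hk l_r.
have [c neigc] := noneigenvector_shift y phi_inj neig0.
have -> : y = (y + c *: y0) + (- c) *: y0 by rewrite scaleNr addrK.
rewrite linearD linearZ; apply: killedD; last apply: killedZ.
  by apply: good => //; apply: noneigenvector_neq0.
by apply: good => //; apply: noneigenvector_neq0.
Qed.

End BandComponents.

Theorem proposition5 (k : fieldType) (hk : 2%N \in [pchar k])
    (q : nat) (hq2 : (2 <= q)%N) (hq : exists e : nat, q = (2 ^ e)%N)
    (gT : finGroupType) (G : {group gT}) (g h : gT)
    (hG : dihedral_gens G q g h)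
    (d : nat) (N : mx_representation k G d) :
  (forall (w : seq letter) (M : mx_representation k G (size w).+1),
     is_word w -> XY_action g h M (string_mx k w) ->
     exists Mc : forall p : occurrence w,
         mx_representation k G (size (subword p)).+1,
       (forall p, p \in directed_components w ->
          XY_action g h (Mc p) (string_mx k (subword p))) /\
       loewy_length (prod_repr M N) =
         (\max_(p in directed_components w)
            loewy_length (prod_repr (Mc p) N))%N)
  /\
  (forall (m n : nat) (w : seq letter) (phi : 'End('cV[k]_n))
     (M : mx_representation k G #|band_index (size w) n|),
     (0 < m)%N -> (0 < n)%N ->
     is_band_word w -> #|directed_components w| = (2 * m)%N ->
     indecomposable_automorphism phi ->
     XY_action g h M (band_mx w phi) ->
     ~ (m = 1%N /\ n = 1%N) ->
     exists Mc : forall p : occurrence w,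
         mx_representation k G (size (subword p)).+1,
       (forall p, p \in directed_components w ->
          XY_action g h (Mc p) (string_mx k (subword p))) /\
       loewy_length (prod_repr M N) =
         (\max_(p in directed_components w)
            loewy_length (prod_repr (Mc p) N))%N).
Proof.
have [genG oG _] := hG.
have pG : (2.-group G)%g.
  by have [e qE] := hq; rewrite /pgroup oG qE -(expnD 2 2) pnatX pnat_id.
split=> [w M ww MA|m n w phi M m_gt0 n_gt0 [ww [w_gt0 even_w] _ _] comps indec MA mn].
  apply: (loewy_length_components genG hk pG) => [p p_comp|A]; last first.
    exact: string_killed MA.
  have [w0|w_gt0] := posnP (size w).
    have -> : subword p = w.
      by move/size0nil: w0 => w0; move: p {p_comp}; rewrite w0 => -[a b].
    by exists M.
  by apply: string_block MA => //; apply/componentP.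
have even_comps : ~~ odd #|directed_components w| by rewrite comps mul2n odd_double.
have comps_n : (2 < #|directed_components w|)%N || (1 < n)%N.
  rewrite comps; have [m1|] := eqVneq m 1%N; last by lia.
  by have [n1|] := eqVneq n 1%N; [case: mn | lia].
apply: (loewy_length_components genG hk pG) => [p p_comp|A].
  exact: (band_component genG N ww w_gt0 even_w n_gt0 indec MA even_comps comps_n
    p_comp).
exact: (band_killed genG ww w_gt0 even_w indec MA even_comps comps_n).
Qed.
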